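(* For any regular matroid $M=(E,\mathscr{C})$, \[\mathcal{A}_{\overleftrightarrow{M}}(q,y,z)=P_M(q,yz)\quad\text{and}\quad \frac{1}{2^{|E|}}\sum_{\vec M\in\mathrm{Orient}(M)}\mathcal{A}_{\vec M}(q,y,z)=P_M\!\left(q,\frac{y+z}{2}\right).\] Moreover, for any regular oriented matroid $N$, $\mathcal{A}_N(q,y,y)=P_{\underline N}(q,y)$, where $\underline N$ is the underlying unoriented matroid.
   Context: A (oriented) matroid is regular if representable over $\mathbb{R}$ by a totally unimodular matrix. For a regular oriented matroid $N=(A,\mathfrak{C})$ with signed circuits $C=(C^+,C^-)$ and a positive integer $q$, a $q$-coflow is $f:A\to\mathbb{Z}/q\mathbb{Z}$ with $\sum_{a\in C^+}f(a)-\sum_{a\in C^-}f(a)=0$ for all $C$; $f_A^>$ (resp. $f_A^<$) is the set of $a$ with $f(a)$ (resp. $-f(a)$) congruent mod $q$ to an element of $\{1,\ldots,\lfloor q/2\rfloor\}$. The $A$-polynomial $\mathcal{A}_N(q,y,z)$ is the unique polynomial with $\mathcal{A}_N(q,y,z)=\sum_{f\ q\text{-coflow}}y^{|f_A^>|}z^{|f_A^<|}$ for all odd positive $q$. The Tutte polynomial is $T_M(x,y)=\sum_{S\subseteq E}(x-1)^{\mathrm{rk}(E)-\mathrm{rk}(S)}(y-1)^{|S|-\mathrm{rk}(S)}$ and the Potts polynomial is $P_M(q,y)=y^{|E|}(1/y-1)^{\mathrm{rk}(E)}T_M(1+\frac{q}{1/y-1},\frac1y)$. For a regular matroid $M$,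 $\overleftrightarrow{M}$ is the oriented matroid obtained by choosing an orientation $\vec M$ of $M$ and adding, for each element $e$, an element $e'$ opposite to $e$ (a parallel copy of $e$ that is then reoriented, so $(\{e,e'\},\emptyset)$ is a signed circuit); this is well defined up to isomorphism. $\mathrm{Orient}(M)$ is the family of the $2^{|E|}$ oriented matroids obtained from $\overleftrightarrow{M}$ by deleting one element from each pair $\{e,e'\}$ (each choice counted separately). *)

(* Defs.v *)
From mathcomp Require Import all_boot all_order all_algebra.
From mathcomp Require Import mpoly.
From mathcomp Require classical_sets.
From mathcomp Require Import reals.
Set Implicit Arguments.
Unset Strict Implicit.
Unset Printing Implicit Defensive.
Import Order.TTheory GRing.Theory Num.Theory.
Local Open Scope ring_scope.

(** * Matroids, by circuits *)

Record matroid (E : finType) := Matroid {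
  circuits : {set {set E}};
  circuit_neq0 : set0 \notin circuits;
  circuit_min : {in circuits &, forall C D : {set E}, C \subset D -> C = D};
  circuit_elim : {in circuits &, forall (C D : {set E}) (e : E), C != D -> e \in C :&: D ->
    exists2 B, B \in circuits & B \subset (C :|: D) :\ e} }.

Definition independent (E : finType) (M : matroid E) (S : {set E}) : bool :=
  [forall C in circuits M, ~~ (C \subset S)].

Definition rk (E : finType) (M : matroid E) (S : {set E}) : nat :=
  \max_(I : {set E} | (I \subset S) && independent M I) #|I|.

(** * Oriented matroids, by signed circuits [(C^+, C^-)] *)

Definition signed_set (A : finType) : Type := ({set A} * {set A})%type.

Definition sopp (A : finType) (X : signed_set A) : signed_set A := (X.2, X.1).

Definition ssupp (A : finType) (X : signed_set A) : {set A} := X.1 :|: X.2.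

Record oriented_matroid (A : finType) := OrientedMatroid {
  scircuits : {set {set A} * {set A}};
  scircuit_disjoint : {in scircuits, forall X : signed_set A, [disjoint X.1 & X.2]};
  scircuit_neq0 : (set0, set0) \notin scircuits;
  scircuit_opp : {in scircuits, forall X : signed_set A, sopp X \in scircuits};
  scircuit_min : {in scircuits &, forall X Y : signed_set A,
    ssupp X \subset ssupp Y -> X = Y \/ X = sopp Y};
  scircuit_elim : {in scircuits &, forall (X Y : signed_set A) (e : A),
    X != sopp Y -> e \in X.1 :&: Y.2 ->
    exists2 Z, Z \in scircuits &
      Z.1 \subset (X.1 :|: Y.1) :\ e /\ Z.2 \subset (X.2 :|: Y.2) :\ e} }.

(** ** Underlying matroid *)

Section Underlying.
Variables (A : finType) (N : oriented_matroid A).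

Definition underlying_circuits : {set {set A}} :=
  [set ssupp X | X in scircuits N].

Lemma underlying_neq0 : set0 \notin underlying_circuits.
Proof.
apply/imsetP => -[[X1 X2] XN /esym/eqP]; rewrite setU_eq0 /= => /andP[/eqP e1 /eqP e2].
by move: XN; rewrite e1 e2 (negPf (scircuit_neq0 N)).
Qed.

Lemma ssupp_opp (X : signed_set A) : ssupp (sopp X) = ssupp X.
Proof. by rewrite /ssupp setUC. Qed.

Lemma underlying_min :
  {in underlying_circuits &, forall C D : {set A}, C \subset D -> C = D}.
Proof.
move=> _ _ /imsetP[X XN ->] /imsetP[Y YN ->] sXY.
by have [->|->] := scircuit_min XN YN sXY; rewrite ?ssupp_opp.
Qed.

Lemma underlying_elim : {in underlying_circuits &, forall (C D : {set A}) (e : A),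
  C != D -> e \in C :&: D ->
  exists2 B, B \in underlying_circuits & B \subset (C :|: D) :\ e}.
Proof.
move=> _ _ /imsetP[X XN ->] /imsetP[Y YN ->] e neqXY; rewrite inE => /andP[eX eY].
wlog eX1 : X XN neqXY eX / e \in X.1.
  move=> W; case/setUP: (eX) => h; first exact: W.
  by have := W (sopp X) (scircuit_opp XN); rewrite ssupp_opp; apply.
wlog eY2 : Y YN neqXY eY / e \in Y.2.
  move=> W; case/setUP: (eY) => h; last exact: W.
  by have := W (sopp Y) (scircuit_opp YN); rewrite ssupp_opp; apply.
have neqXoY : X != sopp Y by apply: contraNneq neqXY => ->; rewrite ssupp_opp.
have eXY : e \in X.1 :&: Y.2 by rewrite inE eX1.
have [Z ZN [sZ1 sZ2]] := scircuit_elim XN YN neqXoY eXY.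
exists (ssupp Z); first exact: imset_f.
rewrite /ssupp setUACA setDUl; exact: setUSS.
Qed.

Definition underlying : matroid A :=
  Matroid underlying_neq0 underlying_min underlying_elim.

End Underlying.

(** ** Deletion *)

Section Deletion.
Variables (A : finType) (N : oriented_matroid A) (D : {set A}).
Let B := {a : A | a \notin D}.

Definition emb (X : signed_set B) : signed_set A :=
  (val @: X.1, val @: X.2).

Definition del_scircuits : {set {set B} * {set B}} :=
  [set X | emb X \in scircuits N].

Lemma emb_inj : injective emb.
Proof.
have I := imset_inj (@val_inj _ _ B).
by move=> [X1 X2] [Y1 Y2] [/I-> /I->].
Qed.

Lemma ssupp_emb X : ssupp (emb X) = val @: ssupp X.
Proof. by rewrite /ssupp imsetU. Qed.

Lemma del_disjoint : {in del_scircuits, forall X : signed_set B, [disjoint X.1 & X.2]}.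
Proof.
move=> X; rewrite inE => /scircuit_disjoint /=.
by rewrite imset_disjoint //; apply: val_inj.
Qed.

Lemma del_neq0 : (set0, set0) \notin del_scircuits.
Proof. by rewrite inE /emb !imset0 scircuit_neq0. Qed.

Lemma del_opp : {in del_scircuits, forall X : signed_set B, sopp X \in del_scircuits}.
Proof. by move=> X; rewrite !inE => /scircuit_opp. Qed.

Lemma del_min : {in del_scircuits &, forall X Y : signed_set B,
  ssupp X \subset ssupp Y -> X = Y \/ X = sopp Y}.
Proof.
move=> X Y; rewrite !inE => XN YN sXY.
have sE : ssupp (emb X) \subset ssupp (emb Y) by rewrite !ssupp_emb imsetS.
have [/emb_inj|E] := scircuit_min XN YN sE; first by left.
by right; apply: emb_inj.
Qed.

Lemma del_elim : {in del_scircuits &, forall (X Y : signed_set B) (e : B),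
  X != sopp Y -> e \in X.1 :&: Y.2 ->
  exists2 Z, Z \in del_scircuits &
    Z.1 \subset (X.1 :|: Y.1) :\ e /\ Z.2 \subset (X.2 :|: Y.2) :\ e}.
Proof.
move=> X Y; rewrite !inE => XN YN e nXY; rewrite inE => /andP[eX eY].
have nE : emb X != sopp (emb Y).
  by apply: contraNneq nXY => h; apply/eqP/emb_inj.
have eE : val e \in (emb X).1 :&: (emb Y).2 by rewrite inE !imset_f.
have [Z ZN [s1 s2]] := scircuit_elim XN YN nE eE.
have pull (S : {set A}) (U V : {set B}) :
    S \subset (val @: U :|: val @: V) :\ val e ->
    exists2 W : {set B}, S = val @: W & W \subset (U :|: V) :\ e.
  move=> sS; exists (val @^-1: S).
    apply/setP => a; apply/idP/imsetP => [aS|[w /[!inE] wS -> //]].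
    have := subsetP sS a aS; rewrite -imsetU !inE => /andP[_ /imsetP[w _ Ea]].
    by exists w => //; rewrite inE -Ea.
  apply/subsetP => w; rewrite inE => /(subsetP sS); rewrite -imsetU !inE.
  by rewrite (inj_eq val_inj) mem_imset ?inE //; apply: val_inj.
have [W1 E1 sW1] := pull _ _ _ s1; have [W2 E2 sW2] := pull _ _ _ s2.
by exists (W1, W2); rewrite // inE /emb /= -E1 -E2; case: (Z) ZN.
Qed.

Definition deletion : oriented_matroid B :=
  OrientedMatroid del_disjoint del_neq0 del_opp del_min del_elim.

End Deletion.

(** ** Doubling: each element [e] becomes [(e, false)], and its opposite [e']
    is [(e, true)]. *)

Section Doubling.
Variables (E : finType) (N : oriented_matroid E).

(* The signed circuit [C] with every element [e] such that [s e] replaced by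
   its opposite, which changes the sign. *)
Definition lift (s : {ffun E -> bool}) (C : signed_set E) : signed_set (E * bool)%type :=
  ([set x | (x.2 == s x.1) && (x.1 \in if x.2 then C.2 else C.1)],
   [set x | (x.2 == s x.1) && (x.1 \in if x.2 then C.1 else C.2)]).

Definition digon (e : E) (b : bool) : signed_set (E * bool)%type :=
  let P := [set x : (E * bool)%type | x.1 == e] in if b then (P, set0) else (set0, P).

(* If [e] is a loop, then so are both of its copies, and they do not form
   a circuit together. *)
Definition loop (e : E) : bool := ([set e], set0) \in scircuits N.

Definition double_scircuits : {set {set (E * bool)%type} * {set (E * bool)%type}} :=
  [set X | [exists e, ~~ loop e && [exists b, X == digon e b]]
        || [exists C in scircuits N, [exists s, X == lift s C]]].

Variant double_spec (X : signed_set (E * bool)%type) : Prop :=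
  | DoubleDigon e b of ~~ loop e & X = digon e b
  | DoubleLift s C of C \in scircuits N & X = lift s C.

Lemma doubleP X : reflect (double_spec X) (X \in double_scircuits).
Proof.
rewrite inE; apply: (iffP orP) => [[]|[e b Le ->|s C CN ->]].
- by move=> /existsP[e /andP[Le /existsP[b /eqP->]]]; apply: DoubleDigon Le _.
- by move=> /existsP[C /andP[CN /existsP[s /eqP->]]]; apply: DoubleLift CN _.
- by left; apply/existsP; exists e; rewrite Le; apply/existsP; exists b.
- by right; apply/existsP; exists C; rewrite CN; apply/existsP; exists s.
Qed.

Lemma sopp_lift s C : sopp (lift s C) = lift s (sopp C).
Proof. by []. Qed.

Lemma sopp_digon e b : sopp (digon e b) = digon e (~~ b).
Proof. by case: b. Qed.

Lemma mem_ssupp_lift s C x :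
  (x \in ssupp (lift s C)) = (x.2 == s x.1) && (x.1 \in ssupp C).
Proof. by rewrite !inE -andb_orr; case: x.2; rewrite // orbC. Qed.

Lemma mem_ssupp_digon e b x : (x \in ssupp (digon e b)) = (x.1 == e).
Proof. by case: b; rewrite !inE ?orbF. Qed.

Lemma loopP e C : C \in scircuits N -> ssupp C \subset [set e] -> loop e.
Proof.
move=> CN sC; have dC := scircuit_disjoint CN.
have [C1 C2] : C.1 \subset [set e] /\ C.2 \subset [set e].
  by apply/andP; rewrite -subUset.
rewrite /loop; case: C CN dC {sC} C1 C2 => [C1 C2] /= CN dC.
rewrite !subset1 => /orP[]/eqP E1 /orP[]/eqP E2; rewrite {}E1 {}E2 in CN dC *.
- by have /pred0P/(_ e) := dC; rewrite /= !inE eqxx.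
- by [].
- exact: scircuit_opp CN.
- by have := scircuit_neq0 N; rewrite CN.
Qed.

Lemma double_disjoint : {in double_scircuits, forall X : signed_set (E * bool)%type, [disjoint X.1 & X.2]}.
Proof.
move=> _ /doubleP[e [] _ ->|s C CN ->] /=.
- by rewrite -setI_eq0 setI0.
- by rewrite -setI_eq0 set0I.
apply/pred0P => x; rewrite /= !inE; have /pred0P/(_ x.1) /= := scircuit_disjoint CN.
by case: eqP => //= _; case: x.2 => //; rewrite andbC.
Qed.

Lemma double_neq0 : (set0, set0) \notin double_scircuits.
Proof.
apply/doubleP => -[e b _ h|s C CN h].
  by have := mem_ssupp_digon e b (e, b); rewrite -h !inE eqxx.
have sC e : (e \in ssupp C) = false.
  by have := mem_ssupp_lift s C (e, s e); rewrite -h !inE eqxx.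
have := scircuit_neq0 N; suff <- : C = (set0, set0) by rewrite CN.
case: C sC {CN h} => C1 C2 sC.
congr pair; apply/setP => e; have := sC e; rewrite !inE /= => /norP[].
  by move/negPf.
by move=> _ /negPf.
Qed.

Lemma double_opp : {in double_scircuits, forall X : signed_set (E * bool)%type, sopp X \in double_scircuits}.
Proof.
move=> _ /doubleP[e b Le ->|s C CN ->]; apply/doubleP.
  by rewrite sopp_digon; apply: DoubleDigon Le _.
by rewrite sopp_lift; apply: DoubleLift (scircuit_opp CN) _.
Qed.

Lemma eq_lift (s t : {ffun E -> bool}) C : {in ssupp C, s =1 t} -> lift s C = lift t C.
Proof.
move=> st; suff st' x (P : {set E}) : P \subset ssupp C ->
    (x.2 == s x.1) && (x.1 \in P) = (x.2 == t x.1) && (x.1 \in P).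
  by congr pair; apply/setP => -[e b]; rewrite !inE /=;
    apply: (st' (e, b)); case: b; rewrite ?subsetUl ?subsetUr.
by move/subsetP=> sP; case xP: (x.1 \in P); rewrite ?andbF // st ?sP.
Qed.

Lemma double_min : {in double_scircuits &, forall X Y : signed_set (E * bool)%type,
  ssupp X \subset ssupp Y -> X = Y \/ X = sopp Y}.
Proof.
move=> _ _ /doubleP[e b Le ->|s C CN ->] /doubleP[f c Lf ->|t D DN ->] /subsetP sXY.
- have := sXY (e, b); rewrite !mem_ssupp_digon /= => /(_ (eqxx _))/eqP<-.
  by rewrite sopp_digon; case: (b) (c) => [] []; auto.
- have := sXY (e, ~~ t e); rewrite mem_ssupp_digon mem_ssupp_lift /= => /(_ (eqxx _)).
  by case: (t e).
- case/negP: Lf; apply: (loopP CN); apply/subsetP => e eC; rewrite inE.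
  have := sXY (e, s e); rewrite mem_ssupp_digon mem_ssupp_lift /=; apply.
  by rewrite eqxx.
- have {}sXY e : e \in ssupp C -> s e = t e /\ e \in ssupp D.
    move=> eC; have := sXY (e, s e); rewrite !mem_ssupp_lift /= eqxx => /(_ eC).
    by case/andP => /eqP.
  have st : {in ssupp C, s =1 t} by move=> e /sXY[].
  have sCD : ssupp C \subset ssupp D by apply/subsetP => e /sXY[].
  rewrite (eq_lift st) sopp_lift.
  by have [->|->] := scircuit_min CN DN sCD; auto.
Qed.

Lemma double_elim : {in double_scircuits &, forall (X Y : signed_set (E * bool)%type)
    (x : (E * bool)%type),
  X != sopp Y -> x \in X.1 :&: Y.2 ->
  exists2 Z, Z \in double_scircuits &
    Z.1 \subset (X.1 :|: Y.1) :\ x /\ Z.2 \subset (X.2 :|: Y.2) :\ x}.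
Proof.
pose rep s e b : {ffun E -> bool} := [ffun f => if f == e then b else s f].
move=> _ _ /doubleP[e b Le ->|s C CN ->] /doubleP[f c Lf ->|t D DN ->] [g d] nXY.
- move: nXY; rewrite sopp_digon; case: b c => [] []; rewrite !inE ?andbF //=.
  by move=> nfe /andP[/eqP-> /eqP ?]; subst f; rewrite eqxx in nfe.
- case: b nXY => _; rewrite !inE //= => /and3P[/eqP? /eqP? gD]; subst e d.
  exists (lift (rep t g (~~ t g)) D); first by apply/doubleP; apply: DoubleLift DN _.
  split; apply/subsetP => -[h b]; rewrite !inE /= ffunE xpair_eqE.
    by case: (h =P g) => [->|_] //=; rewrite ?andbT ?andbF //; case: b (t g) => [] [].
  case: (h =P g) => [->|_] //=.
  have /pred0P/(_ g) /= := scircuit_disjoint DN.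
  by move: gD; case: b (t g) => [] [] //= ->; rewrite ?andbT /= => ->.
- case: c nXY => _; rewrite !inE ?andbF //= => /andP[/andP[/eqP? gC] /eqP?]; subst f d.
  exists (lift (rep s g (~~ s g)) C); first by apply/doubleP; apply: DoubleLift CN _.
  split; apply/subsetP => -[h b]; rewrite !inE /= ffunE xpair_eqE.
    case: (h =P g) => [->|_] //=; last by rewrite orbF.
    have /pred0P/(_ g) /= := scircuit_disjoint CN.
    by move: gC; case: b (s g) => [] [] //= ->; rewrite ?andbT /= => ->.
  by case: (h =P g) => [->|_] //=; rewrite ?orbT ?andbT ?orbF //; case: b (s g) => [] [].
rewrite !inE /= => /andP[/andP[/eqP? gC] /andP[/eqP st gD]]; subst d.
have [ECD|nCD] := eqVneq C (sopp D).
  have /existsP[h /andP[hC nst]] : [exists h, (h \in ssupp C) && (s h != t h)].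
    apply: contraR nXY => /existsPn nst; rewrite sopp_lift -ECD; apply/eqP/eq_lift => h hC.
    by have := nst h; rewrite hC negbK => /eqP.
  have gsC : g \in ssupp C by move: gC; rewrite inE; case: (s g) => ->; rewrite ?orbT.
  have ngh : h != g by apply: contraNneq nst => ->; rewrite st.
  have Lh : ~~ loop h.
    apply/negP => Lh; have sh : ssupp ([set h], set0) \subset ssupp C.
      by rewrite /ssupp setU0 sub1set.
    suff E0 : [set h] = ssupp C by move: gsC; rewrite -E0 inE eq_sym (negPf ngh).
    have -> : [set h] = ssupp ([set h], set0) by rewrite /ssupp setU0.
    by have [->|->] := scircuit_min Lh CN sh; rewrite ?ssupp_opp.
  have D1 : D.1 = C.2 by rewrite ECD.
  have D2 : D.2 = C.1 by rewrite ECD.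
  have /pred0P/(_ h) /= dC := scircuit_disjoint CN.
  exists (digon h (h \in if s h then C.2 else C.1)).
    by apply/doubleP; apply: DoubleDigon Lh _.
  move: hC dC; rewrite inE; case Es: (s h) nst => nst;
    case Et: (t h) nst => // _ hC dC; rewrite /digon;
    case: ifP => hs; split; rewrite ?sub0set //; apply/subsetP => -[k b];
    rewrite !inE /= => /eqP->; rewrite xpair_eqE (negPf ngh) D1 D2 Es Et /=.
  - by case: b; rewrite /= hs ?orbT.
  - by move: hC; rewrite hs orbF; case: b => /= ->; rewrite ?orbT.
  - by case: b; rewrite /= hs ?orbT.
  - by move: hC; rewrite hs; case: b => /= ->; rewrite ?orbT.
have [Z ZN [/subsetP sZ1 /subsetP sZ2]] : exists2 Z, Z \in scircuits N &
    Z.1 \subset (C.1 :|: D.1) :\ g /\ Z.2 \subset (C.2 :|: D.2) :\ g.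
  case: (s g) gC gD => gC gD.
    have nDC : D != sopp C.
      by apply: contraNneq nCD => ->; rewrite /sopp -surjective_pairing.
    have gDC : g \in D.1 :&: C.2 by rewrite inE gD.
    have [Z ZN h] := scircuit_elim DN CN nDC gDC.
    by exists Z; rewrite // [C.1 :|: _]setUC [C.2 :|: _]setUC.
  by apply: scircuit_elim => //; rewrite inE gC.
pose u : {ffun E -> bool} := [ffun h =>
  if (h \in Z.1) && (h \in C.1) || (h \in Z.2) && (h \in C.2) then s h else t h].
exists (lift u Z); first by apply/doubleP; apply: DoubleLift ZN _.
have dZ h : (h \in Z.1) && (h \in Z.2) = false.
  by have /pred0P/(_ h) := scircuit_disjoint ZN.
have aux (b b1 b2 P Q : bool) : b = (if P then b1 else b2) -> P || Q ->
    (b == b1) && P || (b == b2) && Q.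
  by case: P; case: Q => //= -> _; rewrite eqxx ?orbT.
by split; apply/subsetP => -[h b]; rewrite !inE /= ffunE xpair_eqE;
  move: (dZ h) (sZ1 h) (sZ2 h); rewrite !inE; case: b;
  case: (h \in Z.1) => //=; case: (h \in Z.2) => //= _ h1 h2 /andP[/eqP Eb] //= _;
  try (have /andP[/negPf-> ?] := h1 isT); try (have /andP[/negPf-> ?] := h2 isT);
  rewrite ?orbF in Eb; exact: aux.
Qed.

Definition opposite_double : oriented_matroid (E * bool)%type :=
  OrientedMatroid double_disjoint double_neq0 double_opp double_min double_elim.

(* The member of [Orient(M)] obtained by deleting, for each [e], the copy
   [(e, s e)]. *)
Definition orient (s : {ffun E -> bool}) :=
  deletion opposite_double [set (e, s e) | e in E].

End Doubling.

(** * Regularity *)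

Section Regular.
Variable R : realType.

Definition totally_unimodular m n (U : 'M[R]_(m, n)) : Prop :=
  forall k (f : 'I_k -> 'I_m) (g : 'I_k -> 'I_n), injective f -> injective g ->
    \det (mxsub f g U) \in [:: 0; 1; -1].

(* The columns of [U] are indexed by the elements of [E], through [enum_rank]. *)
Definition dependency (E : finType) m (U : 'M[R]_(m, #|E|)) (x : {ffun E -> R}) : Prop :=
  \sum_e x e *: col (enum_rank e) U = 0.

Definition dependent (E : finType) m (U : 'M[R]_(m, #|E|)) (S : {set E}) : Prop :=
  exists x : {ffun E -> R},
    [/\ dependency U x, x <> [ffun => 0] & forall e, x e != 0 -> e \in S].

Definition represents (E : finType) m (U : 'M[R]_(m, #|E|)) (M : matroid E) : Prop :=
  forall C : {set E}, C \in circuits M <->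
    dependent U C /\ forall D : {set E}, D \proper C -> ~ dependent U D.

Definition srepresents (E : finType) m (U : 'M[R]_(m, #|E|))
    (N : oriented_matroid E) : Prop :=
  forall C : signed_set E, C \in scircuits N <->
    exists x : {ffun E -> R},
      [/\ dependency U x, x <> [ffun => 0],
          C = ([set e | 0 < x e], [set e | x e < 0])
        & forall D : {set E}, D \proper ssupp C -> ~ dependent U D].

Definition regular (E : finType) (M : matroid E) : Prop :=
  exists m (U : 'M[R]_(m, #|E|)), totally_unimodular U /\ represents U M.

Definition oregular (E : finType) (N : oriented_matroid E) : Prop :=
  exists m (U : 'M[R]_(m, #|E|)), totally_unimodular U /\ srepresents U N.

(* Orientations are required to be regular, as the A-polynomial is only
   defined for regular oriented matroids. *)
Definition orientation (E : finType) (M : matroid E) (N : oriented_matroid E) : Prop :=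
  oregular N /\ circuits (underlying N) = circuits M.

End Regular.

(** * Coflows and the A-polynomial *)

(* The additive group Z/qZ for q = n + 1 is ['I_n.+1]. *)
Section Coflows.
Variables (A : finType) (N : oriented_matroid A) (n : nat).

Definition coflow (f : {ffun A -> 'I_n.+1}) : bool :=
  [forall C in scircuits N, \sum_(a in C.1) f a - \sum_(a in C.2) f a == 0].

Definition pos_set (f : {ffun A -> 'I_n.+1}) : {set A} :=
  [set a | (0 < f a <= n.+1./2)%N].

Definition neg_set (f : {ffun A -> 'I_n.+1}) : {set A} :=
  [set a | (0 < (- f a)%R <= n.+1./2)%N].

End Coflows.

Definition vq : {mpoly rat[3]} := 'X_(@Ordinal 3 0 isT).
Definition vy : {mpoly rat[3]} := 'X_(@Ordinal 3 1 isT).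
Definition vz : {mpoly rat[3]} := 'X_(@Ordinal 3 2 isT).

Definition is_A_polynomial (A : finType) (N : oriented_matroid A) (P : {mpoly rat[3]}) : Prop :=
  forall n : nat, odd n.+1 ->
    P \mPo [tuple n.+1%:R; vy; vz] =
    \sum_(f : {ffun A -> 'I_n.+1} | coflow N f)
      vy ^+ #|pos_set f| * vz ^+ #|neg_set f|.

(* [0] is a dummy value, for those [N] (necessarily not regular) without
   an A-polynomial. *)
Definition A_polynomial (A : finType) (N : oriented_matroid A) : {mpoly rat[3]} :=
  classical_sets.xget 0 (is_A_polynomial N).

(** * Tutte and Potts polynomials *)

Definition tutte (K : fieldType) (E : finType) (M : matroid E) (x y : K) : K :=
  \sum_(S : {set E})
    (x - 1) ^+ (rk M setT - rk M S) * (y - 1) ^+ (#|S| - rk M S).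

(* To be used at values with [y] distinct from 0 and 1, in particular at
   indeterminates. *)
Definition potts (K : fieldType) (E : finType) (M : matroid E) (q y : K) : K :=
  y ^+ #|E| * (1 / y - 1) ^+ rk M setT * tutte M (1 + q / (1 / y - 1)) (1 / y).

(* Main.v *)
Require Import Defs.
From mathcomp Require Import all_boot all_order all_algebra.
From mathcomp Require Import mpoly.
From mathcomp Require Import boolp reals lra zify ring.
Set Implicit Arguments.
Unset Strict Implicit.
Unset Printing Implicit Defensive.
Import Order.TTheory GRing.Theory Num.Theory.
Local Open Scope ring_scope.

(* Total unimodularity makes every circuit of [N] a dependency with coefficients
   +-1, and any real vector whose circuit sums are integers can then be rounded
   to an integer vector with the same circuit sums. Rounding gives
   [q ^ (rk E - rk S)] coflows modulo [q] vanishing on [S], so that summing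
   [w ^ #|supp f|] over the coflows [f] gives the Potts polynomial at [w]. On the
   double, [y] and [z] both have the exponent [#|supp f|], and averaging over the
   orientations replaces the weights [y] and [z] of each element by [(y + z) / 2].
   The A-polynomial exists because the number of coflows with given signs is a
   polynomial in the odd number [q]. To see this, double the coflow, which turns
   signs into parities of representatives in [0, q - 1], and view it as a lattice
   point of the [q]-th dilate of a face of the polytope of points of the unit cube
   with given integral circuit sums. Rounding provides a 0/1-vertex [v] of this face;
   subtracting [v] maps the relatively open [q]-th dilate bijectively to a disjoint
   union of open [(q - 1)]-th dilates, of this face and of faces avoiding [v]. Applying
   this twice restores the parities, and the counts are polynomials on odd and on
   even [q] by induction on the dimension. *)

(** * Circuit sums and total unimodularity *)

(** Values lie in any abelian group: the same sums are taken over the reals, the integers and Z/q,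
    and additive maps carry them from one to another. *)
Definition csum (E : finType) (V : zmodType) (C : signed_set E) (w : E -> V) : V :=
  \sum_(a in C.1) w a - \sum_(a in C.2) w a.

Section Csum.
Variables (E : finType) (V : zmodType) (C : signed_set E).
Implicit Types w : E -> V.

Lemma eq_csum w w' : {in ssupp C, w =1 w'} -> csum C w = csum C w'.
Proof.
move=> eq_w; congr (_ - _); apply: eq_bigr => a aC; apply: eq_w;
  by rewrite inE aC ?orbT.
Qed.

Lemma csumD w w' : csum C (fun a => w a + w' a) = csum C w + csum C w'.
Proof. by rewrite /csum !big_split /= opprD addrACA. Qed.

Lemma csum0 : csum C (fun=> 0 : V) = 0.
Proof. by rewrite /csum !big1 ?subr0. Qed.

Lemma csum_sopp w : csum (sopp C) w = - csum C w.
Proof. by rewrite /csum /= opprB. Qed.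

Lemma raddf_csum (W : zmodType) (h : {additive V -> W}) w :
  h (csum C w) = csum C (h \o w).
Proof. by rewrite /csum raddfB !raddf_sum. Qed.

Lemma csum_split w a : [disjoint C.1 & C.2] -> a \in ssupp C ->
  csum C w = csum C (fun b => if b == a then 0 else w b)
             + (if a \in C.1 then w a else - w a).
Proof.
move=> dC aC.
have sumE (S : {set E}) : \sum_(b in S) w b =
    \sum_(b in S) (if b == a then 0 else w b) + (if a \in S then w a else 0).
  case: ifP => aS; last first.
    rewrite addr0; apply: eq_bigr => b bS.
    by case: eqP => // ba; rewrite -ba bS in aS.
  rewrite (bigD1 a) //= [in RHS](bigD1 a) //= eqxx add0r addrC; congr (_ + _).
  by apply: eq_bigr => b /andP[_ /negPf->].
rewrite /csum (sumE C.1) (sumE C.2); have /pred0P/(_ a) /= := dC.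
move: aC; rewrite inE; case: (a \in C.1) => /= [_ ->|-> _].
  by rewrite addr0 addrAC.
by rewrite addr0 opprD addrA.
Qed.

End Csum.

Lemma csumZ (E : finType) (V : pzRingType) (C : signed_set E) (k : V) (w : E -> V) :
  csum C (fun a => k * w a) = k * csum C w.
Proof. by rewrite /csum -!mulr_sumr mulrBr. Qed.

Section TotallyUnimodular.
Variables (R : realType) (E : finType) (m : nat) (U : 'M[R]_(m, #|E|)).
Hypothesis tuU : totally_unimodular U.

Lemma dependencyP (x : {ffun E -> R}) :
  dependency U x <-> forall i, \sum_e x e * U i (enum_rank e) = 0.
Proof.
rewrite /dependency; split=> [xU i|xU].
  have := congr1 (fun M : 'cV_m => M i ord0) xU; rewrite summxE [RHS]mxE; apply: etrans.
  by apply: eq_bigr => e _; rewrite !mxE.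
apply/colP => i; rewrite summxE [RHS]mxE; apply: etrans (xU i).
by apply: eq_bigr => e _; rewrite !mxE.
Qed.

(* Cramer's rule, for a nonsingular square submatrix supported on all of the
   circuit but one element. *)
Lemma minimal_dependency_le (x : {ffun E -> R}) (a b : E) :
  dependency U x -> (forall D : {set E}, D \proper [set e | x e != 0] -> ~ dependent U D) ->
  x a != 0 -> x b != 0 -> `|x a| <= `|x b|.
Proof.
move=> xU minx xa xb; have [->//|nab] := eqVneq a b.
pose T := [set e | x e != 0] :\ b.
have ltT : T \proper [set e | x e != 0] by rewrite properD1 ?inE.
pose g (i : 'I_#|T|) : 'I_#|E| := enum_rank (enum_val i).
have g_inj : injective g by move=> i j /enum_rank_inj/enum_val_inj.
(* A proper subset of the minimal support carries no dependency, so these columns are linearly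
   independent. *)
have freeT : row_full (colsub g U).
  rewrite -col_leq_rank -mxrank_tr row_leq_rank; apply: inj_row_free => v vU.
  pose y : {ffun E -> R} := [ffun e => if [pick i | enum_val i == e] is Some i
                                        then v 0 i else 0 : R].
  have y_val i : y (enum_val i) = v 0 i.
    rewrite ffunE; case: pickP => [j /eqP/enum_val_inj->//|/(_ i)].
    by rewrite eqxx.
  have y_out e : e \notin T -> y e = 0.
    move=> eT; rewrite ffunE; case: pickP => // j /eqP ej.
    by rewrite -ej enum_valP in eT.
  have [y0|ny0] := eqVneq y [ffun=> 0].
    by apply/rowP => i; rewrite -y_val y0 !ffunE mxE.
  case: (minx T ltT); exists y; split; [|exact/eqP|].
    apply/dependencyP => i.
    have := congr1 (fun M : 'rV_m => M 0 i) vU; rewrite !mxE => vUi.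
    rewrite (bigID (mem T)) /= addrC big1 ?add0r => [|e eT]; last first.
      by rewrite y_out // mul0r.
    rewrite big_enum_val /= -[RHS]vUi; apply: eq_bigr => j _.
    by rewrite !mxE y_val.
  by move=> e; apply: contraNT => /y_out->.
pose f := fullrankfun freeT.
have f_inj : injective f := @fullrankfun_inj _ _ _ _ freeT.
pose B := mxsub f g U.
have uB : B \in unitmx.
  have := fullrowsub_unit freeT; congr (_ \in unitmx).
  by apply/matrixP => i j; rewrite !mxE.
have TP (i : 'I_#|T|) : x (enum_val i) != 0 /\ enum_val i != b.
  by have := enum_valP i; rewrite !inE => /andP[].
have aT : a \in T by rewrite !inE nab.
pose j := enum_rank_in aT a.
have ja : enum_val j = a by rewrite enum_rankK_in.
(* The column of [b] takes the place of that of [a], as in Cramer's rule. *)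
pose g' k := if k == j then enum_rank b else g k.
have g'_inj : injective g'.
  move=> i k; rewrite /g'; case: eqP => [->|_]; case: eqP => [->|_] //.
  - by move/enum_rank_inj => bk; have [_] := TP k; rewrite -bk eqxx.
  - by move/enum_rank_inj => bi; have [_] := TP i; rewrite bi eqxx.
  - exact: g_inj.
pose B' := mxsub f g' U.
have cramer : \det B * x a = - x b * \det B'.
  pose xv := \col_(i < #|T|) x (enum_val i).
  pose bv := \col_i U (f i) (enum_rank b).
  have Bx : B *m xv = - x b *: bv.
    apply/colP => i; rewrite !mxE; have /dependencyP/(_ (f i)) := xU.
    rewrite (bigD1 b) //= => /eqP; rewrite addr_eq0 mulNr => /eqP ->.
    rewrite opprK [RHS](bigID (mem T)) /= [X in _ = _ + X]big1 ?addr0; last first.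
      move=> e /andP[eb]; rewrite !inE eb /= negbK => /eqP->.
      by rewrite mul0r.
    rewrite [RHS](eq_bigl (mem T)) => [|e]; last first.
      by rewrite !inE; case: eqP.
    rewrite [RHS]big_enum_val; apply: eq_bigr => k _.
    by rewrite !mxE mulrC.
  have /(congr1 (fun M : 'cV_#|T| => M j 0)) : \adj B *m (B *m xv) = \adj B *m (- x b *: bv).
    by rewrite Bx.
  rewrite mulmxA mul_adj_mx mul_scalar_mx -scalemxAr !mxE ja => ->.
  congr (_ * _); rewrite (expand_det_col _ j); apply: eq_bigr => i _.
  rewrite !mxE /g' eqxx mulrC; congr (_ * _); rewrite /cofactor.
  congr (_ * \det _); apply/matrixP => k l; rewrite !mxE.
  by rewrite /g' eq_sym (negPf (neq_lift _ _)).
have detB : `|\det B| = 1.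
  move: uB; rewrite unitmxE unitfE; have := tuU f_inj g_inj.
  by rewrite !inE => /or3P[]/eqP-> /eqP; rewrite ?normrN ?normr1.
have := congr1 Num.norm cramer; rewrite !normrM detB mul1r normrN => ->.
rewrite ler_piMr //.
have := tuU f_inj g'_inj.
by rewrite !inE => /or3P[]/eqP->; rewrite ?normrN ?normr1 ?normr0.
Qed.
(** Induction on the support. A dependency [y] on a proper subset either involves [a] and replaces
    [x], or has a multiple whose subtraction kills a coordinate of [x] without changing [x a]. *)
Lemma minimal_dependency (x : {ffun E -> R}) (a : E) :
  dependency U x -> x a != 0 ->
  exists y : {ffun E -> R}, [/\ dependency U y, y a != 0,
    forall e, y e != 0 -> x e != 0 &
    forall D : {set E}, D \proper [set e | y e != 0] -> ~ dependent U D].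
Proof.
have [n] := ubnP #|[set e | x e != 0]|; elim: n x => // n IHn x ltn xU xa.
have [minx|/existsNP[D /not_implyP[ltD /contrapT[y [yU y0 yD]]]]] :=
    pselect (forall D : {set E}, D \proper [set e | x e != 0] -> ~ dependent U D).
  by exists x.
have yx e : y e != 0 -> x e != 0.
  by move/yD; have /properP[/subsetP sD _] := ltD; move/sD; rewrite inE.
have IH (z : {ffun E -> R}) : dependency U z -> z a != 0 -> (forall e, z e != 0 -> x e != 0) ->
    (exists2 e, x e != 0 & z e = 0) -> exists y : {ffun E -> R}, [/\ dependency U y, y a != 0,
    forall e, y e != 0 -> x e != 0 &
    forall D : {set E}, D \proper [set e | y e != 0] -> ~ dependent U D].
  move=> zU za zx [e xe ze].
  have /IHn/(_ zU za)[] : (#|[set e | z e != 0%R]| < n)%N.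
    rewrite -ltnS; apply: leq_trans ltn; rewrite ltnS; apply: proper_card.
    apply/properP; split; first by apply/subsetP => b; rewrite !inE; apply: zx.
    by exists e; rewrite !inE // ze eqxx.
  by move=> t [tU ta tz mint]; exists t; split=> // b /tz/zx.
have [ya|ya] := eqVneq (y a) 0; last first.
  apply: (IH y) => //; have /properP[_ [e]] := ltD; rewrite inE => xe eD.
  by exists e => //; apply/eqP; apply: contraNT eD => /yD.
have /existsP[e ye] : [exists e, y e != 0].
  apply: contra_notT y0 => /existsPn y0; apply/ffunP => e; rewrite ffunE.
  by apply/eqP; have := y0 e; rewrite negbK.
pose z : {ffun E -> R} := [ffun b => x b - x e / y e * y b].
apply: (IH z).
- apply/dependencyP => i; transitivity (\sum_b (x b * U i (enum_rank b)
      - x e / y e * (y b * U i (enum_rank b)))).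
    by apply: eq_bigr => b _; rewrite ffunE mulrBl mulrA.
  rewrite sumrB -mulr_sumr; move/dependencyP: xU => ->; move/dependencyP: yU => ->.
  by rewrite mulr0 subrr.
- by rewrite ffunE ya mulr0 subr0.
- move=> b; rewrite ffunE; apply: contraNneq => xb.
  have /eqP -> : y b == 0 by apply: contraTT (introT eqP xb) => /yx.
  by rewrite mulr0 xb subrr.
- by exists e; rewrite ?yx // ffunE mulfVK ?subrr.
Qed.

Variable N : oriented_matroid E.
Hypothesis repU : srepresents U N.

(** [minimal_dependency_le], used both ways, gives all nonzero coefficients the same absolute value,
    so only their signs matter. *)
Lemma circuit_dependency C i :
  C \in scircuits N -> csum C (fun e => U i (enum_rank e)) = 0.
Proof.
move=> /repU[x [xU x0 -> minx]].
have supE : ssupp ([set e | 0 < x e], [set e | x e < 0]) = [set e | x e != 0].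
  by apply/setP => e; rewrite !inE /= neq_lt orbC.
rewrite supE in minx.
have /existsP[a xa] : [exists e, x e != 0].
  apply: contra_notT x0 => /existsPn x0; apply/ffunP => e; rewrite ffunE.
  by apply/eqP; have := x0 e; rewrite negbK.
have xE e : x e != 0 -> `|x e| = `|x a|.
  move=> xe; apply: le_anti.
  by rewrite !(@minimal_dependency_le x).
apply: (mulfI (x := `|x a|)); first by rewrite normr_eq0.
rewrite mulr0 -csumZ /csum /=; have /dependencyP/(_ i) := xU; apply: etrans.
rewrite [RHS](bigID (fun e => 0 < x e)) /= -sumrN; congr (_ + _).
  apply: eq_big => [e|e]; rewrite inE // => xe.
  by rewrite -(xE e) ?gt_eqF // gtr0_norm.
rewrite [RHS](bigID (fun e => x e < 0)) /= [X in _ = _ + X]big1 ?addr0; last first.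
  move=> e; rewrite -!leNgt => /andP[le1 le2].
  by have -> : x e = 0; [apply: le_anti; rewrite le1 | rewrite mul0r].
apply: eq_big => [e|e]; rewrite inE.
  by rewrite -leNgt andbC; case: (ltP (x e) 0) => //= /ltW.
by move=> xe; rewrite -(xE e) ?lt_eqF // ltr0_norm // mulNr opprK.
Qed.

(* Linear duality: a column outside of a span is separated from it by
   a linear form. *)
Lemma tu_circuit_or_coflow (S : {set E}) a : a \notin S ->
  (exists2 C, C \in scircuits N & a \in ssupp C /\ ssupp C \subset a |: S)
  \/ (exists psi : E -> R, [/\ {in scircuits N, forall C, csum C psi = 0},
        psi a != 0 & {in S, forall b, psi b = 0}]).
Proof.
(* The rows are the columns of [U] in [S], padded by zero rows; the dichotomy is whether their span
   contains the column of [a]. *)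
move=> aS; pose W := \matrix_(k, i) (if enum_val k \in S then U i k else 0).
pose ua := \row_i U i (enum_rank a).
have [/submxP[D uaE]|uaW] := boolP (ua <= W)%MS; [left|right].
  pose x : {ffun E -> R} :=
    [ffun e => if e == a then 1 else if e \in S then - D 0 (enum_rank e) else 0].
  have xa : x a != 0 by rewrite ffunE eqxx oner_eq0.
  have xU : dependency U x.
    apply/dependencyP => i; have := congr1 (fun M : 'rV_m => M 0 i) uaE.
    rewrite !mxE => uaiE; rewrite (bigD1 a) //= ffunE eqxx mul1r uaiE.
    rewrite (reindex (@enum_rank E)) /=; last first.
      by exists enum_val => k _; rewrite ?enum_valK ?enum_rankK.
    rewrite (bigD1 a) //= mxE enum_rankK (negPf aS) mulr0 add0r -big_split big1 //=.
    move=> e /negPf ea; rewrite ffunE ea mxE enum_rankK.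
    by case: ifP => _; rewrite ?mulr0 ?mul0r ?addr0 // mulNr subrr.
  have [y [yU ya yx miny]] := minimal_dependency xU xa.
  have supE : ssupp ([set e | 0 < y e], [set e | y e < 0]) = [set e | y e != 0].
    by apply/setP => e; rewrite !inE /= neq_lt orbC.
  exists ([set e | 0 < y e], [set e | y e < 0]).
    apply/repU; exists y; split; rewrite ?supE // => y0.
    by rewrite y0 ffunE eqxx in ya.
  rewrite supE inE; split=> //; apply/subsetP => e; rewrite !inE => /yx.
  by rewrite ffunE; case: (e =P a) => //= _; case: ifP; rewrite ?eqxx.
move: uaW; rewrite submxE => /eqP nz.
have /existsP[j nzj] : [exists j, (ua *m cokermx W) 0 j != 0].
  apply: contra_notT nz => /existsPn z; apply/rowP => j; rewrite [RHS]mxE.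
  by apply/eqP; have := z j; rewrite negbK.
(* A column of the cokernel kills the rows of [W] but not [ua]. *)
exists (fun e => \sum_i U i (enum_rank e) * cokermx W i j); split.
- move=> C CN.
  rewrite /csum exchange_big [X in _ - X]exchange_big -sumrB big1 // => i _ /=.
  rewrite -!mulr_suml -mulrBl.
  have := circuit_dependency i CN; rewrite /csum => ->; exact: mul0r.
- move: nzj; rewrite mxE; congr (_ != _).
  by apply: eq_bigr => i _; rewrite mxE.
- move=> b bS; have := congr1 (fun M : 'M_(_, _) => M (enum_rank b) j) (mulmx_coker W).
  rewrite [RHS]mxE mxE; apply: etrans.
  by apply: eq_bigr => i _; rewrite [W _ _]mxE enum_rankK bS.
Qed.

End TotallyUnimodular.

(** * Rounding, rank and the number of coflows *)

Lemma rkS (E : finType) (M : matroid E) (S T : {set E}) : S \subset T ->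
  (rk M S <= rk M T)%N.
Proof.
move=> sST; apply/bigmax_leqP => I /andP[IS indI].
by rewrite /rk (bigop.bigmax_sup I) ?(subset_trans IS).
Qed.

Section RegularOriented.
Variables (R : realType) (E : finType) (N : oriented_matroid E).
Hypothesis regN : oregular R N.

Lemma circuit_or_coflow (S : {set E}) a : a \notin S ->
  (exists2 C, C \in scircuits N & a \in ssupp C /\ ssupp C \subset a |: S)
  \/ (exists psi : E -> R, [/\ {in scircuits N, forall C, csum C psi = 0},
        psi a != 0 & {in S, forall b, psi b = 0}]).
Proof. by case: regN => m [U [tuU repU]]; apply: (tu_circuit_or_coflow tuU repU). Qed.

(** Induction on the number of non-integral coordinates. A non-integral [a] cannot be alone in a
    circuit, whose integral sum would make [w a] integral. So some coflow [psi] supported on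
    non-integral coordinates has [psi a != 0], and [w] moves along [psi] until a coordinate becomes
    integral. The bounds say that [v e] is the floor or the ceiling of [w e]. *)
Lemma coflow_rounding (w : E -> R) (c : signed_set E -> int) :
  {in scircuits N, forall C, csum C w = (c C)%:~R} ->
  exists v : E -> int, {in scircuits N, forall C, csum C v = c C} /\
    forall e k, (w e <= k%:~R -> v e <= k) /\ (k%:~R <= w e -> k <= v e).
Proof.
have [n] := ubnP #|[set e | w e \isn't a Num.int]|.
elim: n w => // n IHn w ltn wc.
have [Fr0|[a]] := set_0Vmem [set e | w e \isn't a Num.int].
  have wE e : (Num.floor (w e))%:~R = w e.
    by apply/eqP; rewrite -intrEfloor; have /setP/(_ e) := Fr0; rewrite !inE => /negbFE.
  exists (fun e => Num.floor (w e)); split=> [C CN|e k].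
    apply: (@intr_inj R); rewrite -wc //.
    rewrite (raddf_csum C (intmul (1 : R) : {additive int -> R})).
    by apply: eq_csum => e _ /=; rewrite wE.
  by rewrite -{1 3}[w e]wE !ler_int.
move=> aFr; have aS : a \notin ~: [set e | w e \isn't a Num.int] by rewrite inE negbK.
have [[C CN [aC sC]]|[psi [psiN psia psi0]]] := circuit_or_coflow aS.
  move: aFr; rewrite inE => /negP[].
  have := csum_split w (scircuit_disjoint CN) aC; rewrite wc //.
  set s := csum C _ => cE.
  have sint : s \is a Num.int.
    suff bint b : b \in ssupp C -> (if b == a then 0 else w b) \is a Num.int.
      by apply: rpredB; apply: rpred_sum => b bC; apply: bint; rewrite inE bC ?orbT.
    move=> /(subsetP sC); rewrite !inE; case: eqP => //= _.
    by rewrite negbK.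
  have : (c C)%:~R - s \is a Num.int by rewrite rpredB // intr_int.
  by rewrite cE addrC addKr; case: ifP; rewrite ?rpredN.
have psiFr e : psi e != 0 -> w e \isn't a Num.int.
  by apply: contraR => we; apply/eqP/psi0; rewrite !inE.
pose fl e : R := (Num.floor (w e))%:~R.
have flw e : w e \isn't a Num.int -> fl e < w e < fl e + 1.
  move=> we; have := floor_itv (w e).
  rewrite intrD => /andP[le ->]; rewrite andbT lt_neqAle le andbT.
  by rewrite -intrEfloor.
(* The time at which coordinate [e], moving with speed [psi e], reaches its next integer. *)
pose t e := (if 0 < psi e then fl e + 1 - w e else fl e - w e) / psi e.
pose s := t [arg min_(e < a | psi e != 0) t e]%O.
have [s_le [b psib sE]] : (forall e, psi e != 0 -> s <= t e) /\ exists2 b, psi b != 0 & s = t b.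
  rewrite /s; case: arg_minP => // b psib minb; split=> [e|]; first exact: minb.
  by exists b.
pose w' e := w e + s * psi e.
have tM e : psi e != 0 -> t e * psi e = if 0 < psi e then fl e + 1 - w e else fl e - w e.
  by move=> pe; rewrite /t divfK.
have s_ge0 : 0 <= s.
  have /flw/andP[lt1 lt2] := psiFr b psib.
  have := tM b psib; rewrite -sE; case: ifP => [pb sM|/negbT].
    by rewrite -(pmulr_lge0 _ pb) sM; lra.
  rewrite -leNgt le_eqVlt (negPf psib) /= => pb sM.
  by rewrite -(nmulr_lle0 _ pb) sM; lra.
(* Until the first such time [s], no coordinate crosses an integer, so integral bounds survive. *)
have w'_rounds e : w' e = w e \/
    (w e \isn't a Num.int) /\ fl e <= w' e <= fl e + 1.
  have [p0|pe] := eqVneq (psi e) 0; first by left; rewrite /w' p0 mulr0 addr0.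
  right; have we := psiFr e pe; split=> //; have /andP[lt1 lt2] := flw e we.
  have := tM e pe; have := s_le e pe; rewrite /w'; case: ifP => [p st tE|/negbT].
    have : s * psi e <= t e * psi e by rewrite ler_pM2r.
    have : 0 <= s * psi e by rewrite mulr_ge0 // ltW.
    by rewrite tE; lra.
  rewrite -leNgt le_eqVlt (negPf pe) /= => p st tE.
  have : t e * psi e <= s * psi e by rewrite ler_nM2r.
  have : s * psi e <= 0 by rewrite mulr_ge0_le0 // ltW.
  by rewrite tE; lra.
have lt_w' : (#|[set e | w' e \isn't a Num.int]| < n)%N.
  rewrite -ltnS; apply: leq_trans ltn; rewrite ltnS; apply: proper_card.
  apply/properP; split.
    apply/subsetP => e; rewrite !inE; apply: contraNN => we.
    by have [->//|[]] := w'_rounds e; rewrite we.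
  exists b; rewrite !inE ?psiFr // negbK /w' sE tM //.
  by case: ifP => _; rewrite addrC subrK /fl ?rpredD ?intr_int // rpred1.
have [|v [vc v_rounds]] := IHn w' lt_w'.
  by move=> C CN; rewrite /w' csumD csumZ psiN // mulr0 addr0 wc.
exists v; split=> // e k; have [vle vge] := v_rounds e k.
have [<-//|[we /andP[le1 le2]]] := w'_rounds e.
have /andP[lt1 lt2] := flw e we.
split=> lek; [apply: vle; apply: le_trans le2 _|apply: vge; apply: le_trans le1].
  have : (Num.floor (w e))%:~R < (k%:~R : R) by apply: lt_le_trans lek.
  by rewrite ltr_int -lezD1 -(ler_int R) intrD.
by rewrite ler_int floor_ge_int.
Qed.

(** This rounds [X / q]; the bounds are multiplied by [q] to stay in the integers. *)
Lemma coflow_division (q : nat) (X : E -> int) (c : signed_set E -> int) :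
  (0 < q)%N -> {in scircuits N, forall C, csum C X = q%:Z * c C} ->
  exists v : E -> int, {in scircuits N, forall C, csum C v = c C} /\
    forall e k, (X e <= q%:Z * k -> v e <= k) /\ (q%:Z * k <= X e -> k <= v e).
Proof.
move=> q_gt0 Xc; have q_neq0 : (q%:R : R) != 0 by rewrite pnatr_eq0 -lt0n.
have [|v [vc v_rounds]] := @coflow_rounding (fun e => q%:R^-1 * (X e)%:~R) c.
  move=> C CN; rewrite csumZ -(raddf_csum C (intmul (1 : R) : {additive int -> R})) /=.
  by rewrite Xc // rmorphM /= mulKf.
exists v; split=> // e k; have [vle vge] := v_rounds e k.
split=> Xk; [apply: vle|apply: vge]; rewrite mulrC.
  by rewrite ler_pdivrMr ?ltr0n // pmulrn mulrC -intrM ler_int.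
by rewrite ler_pdivlMr ?ltr0n // pmulrn mulrC -intrM ler_int.
Qed.

Lemma csum_eq0 (V : zmodType) C (w : E -> V) a : C \in scircuits N -> a \in ssupp C ->
  csum C w = 0 -> {in ssupp C, forall b, b != a -> w b = 0} -> w a = 0.
Proof.
move=> CN aC; rewrite (csum_split w (scircuit_disjoint CN) aC) => wC w0.
move: wC; rewrite (@eq_csum _ _ C _ (fun=> 0)) => [|b bC].
  by rewrite csum0 add0r; case: ifP => // _ /eqP; rewrite oppr_eq0 => /eqP.
by case: eqP => // /eqP; apply: w0.
Qed.

(** For [e] outside [S], this is membership in the closure of [S]. *)
Definition spanned (S : {set E}) (e : E) : bool :=
  [exists C in scircuits N, (e \in ssupp C) && (ssupp C \subset e |: S)].

Lemma unspanned_coflow (S : {set E}) e : e \notin S -> ~~ spanned S e ->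
  exists psi : E -> R, [/\ {in scircuits N, forall C, csum C psi = 0},
        psi e != 0 & {in S, forall b, psi b = 0}].
Proof.
move=> eS; case: (circuit_or_coflow eS) => // -[C CN /andP eC] /negP[].
by apply/existsP; exists C; rewrite CN.
Qed.

(** A real coflow scaled to be 1 at [e] is rounded, which fixes its integral values 1 and 0. *)
Lemma unspanned_int_coflow (S : {set E}) e : e \notin S -> ~~ spanned S e ->
  exists v : E -> int, [/\ {in scircuits N, forall C, csum C v = 0},
        v e = 1 & {in S, forall b, v b = 0}].
Proof.
move=> eS /(unspanned_coflow eS)[psi [psiN psie psi0]].
have [|v [vc v_rounds]] := @coflow_rounding (fun a => (psi e)^-1 * psi a) (fun=> 0).
  by move=> C CN; rewrite csumZ psiN ?mulr0.
exists v; split=> [//||b bS]; apply: le_anti; apply/andP; split.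
- by apply: (v_rounds e 1).1; rewrite mulVf.
- by apply: (v_rounds e 1).2; rewrite mulVf.
- by apply: (v_rounds b 0).1; rewrite (psi0 b) // mulr0 mulr0z.
- by apply: (v_rounds b 0).2; rewrite (psi0 b) // mulr0 mulr0z.
Qed.

Lemma independentP (I : {set E}) :
  reflect {in scircuits N, forall C, ~~ (ssupp C \subset I)}
          (independent (underlying N) I).
Proof.
apply: (iffP forallP) => [ind C CN|ind D].
  by have := ind (ssupp C); rewrite imset_f.
by apply/implyP => /imsetP[C CN ->]; apply: ind.
Qed.

Lemma independentS (I J : {set E}) : I \subset J ->
  independent (underlying N) J -> independent (underlying N) I.
Proof.
move=> sIJ /independentP indJ; apply/independentP => C CN.
by apply: contra (indJ C CN) => /subset_trans; apply.
Qed.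

Lemma rk_witness (S : {set E}) : exists2 I : {set E},
  (I \subset S) && independent (underlying N) I & #|I| = rk (underlying N) S.
Proof.
suff : (0 < #|[pred I : {set E} | (I \subset S) && independent (underlying N) I]|)%N.
  by move/eq_bigmax_cond => /(_ (fun I => #|I|))[I IS rkE]; exists I; last exact: esym rkE.
apply/card_gt0P; exists set0; rewrite !inE sub0set; apply/independentP => C CN.
rewrite subset0; apply: contraTN CN => /eqP C0.
suff -> : C = (set0, set0) by exact: scircuit_neq0.
move: C0; rewrite /ssupp; case: C => C1 C2 /eqP; rewrite setU_eq0 /=.
by case/andP => /eqP-> /eqP->.
Qed.

Lemma leq_rk (S I : {set E}) : I \subset S -> independent (underlying N) I ->
  (#|I| <= rk (underlying N) S)%N.
Proof. by move=> IS indI; rewrite /rk (bigop.bigmax_sup I) ?IS. Qed.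

Lemma rk_unspanned (S : {set E}) e : e \notin S -> ~~ spanned S e ->
  rk (underlying N) (e |: S) = (rk (underlying N) S).+1.
Proof.
move=> eS nsp; apply/eqP; rewrite eqn_leq; apply/andP; split.
  have [J /andP[JS indJ] <-] := rk_witness (e |: S).
  rewrite (cardsD1 e) -add1n leq_add ?leq_b1 //; apply: leq_rk.
    by rewrite subDset.
  exact: independentS (subD1set _ _) indJ.
have [I /andP[IS indI] <-] := rk_witness S.
have eI : e \notin I by apply: contra eS => /(subsetP IS).
rewrite -add1n -[1%N]/(true : nat) -eI -cardsU1; apply: leq_rk; first exact: setUS.
apply/independentP => C CN; apply/negP => CI.
have [eC|eC] := boolP (e \in ssupp C).
  case/negP: nsp; apply/existsP; exists C; rewrite CN eC.
  exact: subset_trans CI (setUS _ IS).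
have /independentP/(_ C CN)/negP[] := indI.
apply/subsetP => b bC; have := subsetP CI b bC; rewrite !inE => /orP[/eqP be|//].
by rewrite -be bC in eC.
Qed.

(** If the rank grew, some independent [J] would contain [e], with [J :\ e] a basis of [S]. A coflow
    vanishing on this basis but not at [e] would vanish on [S], hence on [C] outside [e], hence at
    [e]. *)
Lemma rk_spanned (S : {set E}) e : e \notin S -> spanned S e ->
  rk (underlying N) (e |: S) = rk (underlying N) S.
Proof.
move=> eS /existsP[C /and3P[CN eC CS]]; apply/eqP; rewrite eqn_leq andbC (rkS _ (subsetUr _ _)) /=.
have [J /andP[JS indJ] <-] := rk_witness (e |: S); rewrite leqNgt; apply/negP => ltJ.
have eJ : e \in J.
  apply: contraLR ltJ => eJ; rewrite -leqNgt; apply: leq_rk => //.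
  apply/subsetP => b bJ; have := subsetP JS b bJ; rewrite !inE => /orP[/eqP be|//].
  by rewrite -be bJ in eJ.
pose I := J :\ e.
have IS : I \subset S by rewrite subDset.
have eI : e \notin I by rewrite !inE eqxx.
have JE : e |: I = J by rewrite setD1K.
have indI : independent (underlying N) I := independentS (subD1set _ _) indJ.
have leI : (rk (underlying N) S <= #|I|)%N by rewrite (cardsD1 e) eJ in ltJ.
have [|psi [psiN psie psi0]] := @unspanned_coflow I e eI.
  apply/existsPn => D; apply/negP => /and3P[DN _]; rewrite JE.
  by apply/negP; move/independentP: indJ; apply.
case/eqP: psie; apply: (csum_eq0 CN eC (psiN C CN)) => s sC se.
have sS : s \in S by have := subsetP CS s sC; rewrite !inE (negPf se).
have [/psi0//|sI] := boolP (s \in I).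
(* [I] already has at least [rk S] elements. *)
have : ~~ independent (underlying N) (s |: I).
  apply/negP => /leq_rk-/(_ S); rewrite subUset sub1set sS IS => /(_ isT).
  by rewrite cardsU1 sI add1n ltnNge leI.
case/forall_inPn => _ /imsetP[D DN ->] /negPn DI.
have sD : s \in ssupp D.
  apply: contraTT (DI) => sD; have /independentP/(_ D DN) := indI.
  apply: contra => DI'; apply/subsetP => b bD; have := subsetP DI' b bD.
  by rewrite !inE => /orP[/eqP be|//]; rewrite -be bD in sD.
apply: (csum_eq0 DN sD (psiN D DN)) => b bD bs; apply: psi0.
by have := subsetP DI b bD; rewrite !inE (negPf bs).
Qed.

Lemma coflowE n (f : {ffun E -> 'I_n.+1}) :
  coflow N f = [forall C in scircuits N, csum C f == 0].
Proof. by []. Qed.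

Lemma coflowP n (f : {ffun E -> 'I_n.+1}) :
  reflect {in scircuits N, forall C, csum C f = 0} (coflow N f).
Proof. by rewrite coflowE; apply: (iffP forall_inP) => fN C CN; apply/eqP/fN. Qed.

Definition coflows_vanishing n (S : {set E}) : {set {ffun E -> 'I_n.+1}} :=
  [set f | coflow N f & [forall e in S, f e == 0]].

(** Induction on the complement of [S]. If [S] spans [e], vanishing on [S] implies vanishing at [e].
    Otherwise multiples of an integral coflow that is 1 at [e] and 0 on [S] let the value at [e]
    range freely over Z/q, a factor [q]. *)
Lemma card_coflows_vanishing n (S : {set E}) :
  #|coflows_vanishing n S| =
    (n.+1 ^ (rk (underlying N) setT - rk (underlying N) S))%N.
Proof.
have [k] := ubnP #|~: S|; elim: k S => // k IHk S; rewrite ltnS => ltS.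
have [S0|[e]] := set_0Vmem (~: S).
  have -> : S = setT by rewrite -[S]setCK S0 setC0.
  rewrite subnn expn0; apply/eqP/cards1P; exists [ffun=> 0].
  apply/setP => f; rewrite !inE; apply/andP/eqP => [[_ /forall_inP f0]|->].
    by apply/ffunP => a; rewrite ffunE; apply/eqP/f0.
  split; last by apply/forall_inP => a _; rewrite ffunE.
  apply/coflowP => C _; rewrite (eq_csum (w' := fun=> 0)) ?csum0 // => a _.
  by rewrite ffunE.
rewrite inE => eS; have {IHk} := IHk (e |: S).
rewrite setCU setIC -setDE (cardsD1 e) inE eS add1n in ltS *; move/(_ ltS) => IHk.
have [sp|nsp] := boolP (spanned S e).
  rewrite rk_spanned // in IHk; rewrite -IHk; apply: eq_card => f; rewrite !inE.
  apply: andb_id2l => /coflowP fN; apply/forall_inP/forall_inP => f0 a; last first.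
    by move=> aS; apply: f0; rewrite !inE aS orbT.
  rewrite !inE => /orP[/eqP->|/f0//]; apply/eqP.
  case/existsP: sp => C /and3P[CN eC CS]; apply: (csum_eq0 CN eC (fN C CN)) => b bC be.
  by apply/eqP/f0; have := subsetP CS b bC; rewrite !inE (negPf be).
have [v [vN ve v0]] := unspanned_int_coflow eS nsp.
rewrite rk_unspanned // in IHk.
rewrite -subnSK ?expnS; last by rewrite -(rk_unspanned eS nsp) rkS // subsetT.
rewrite -IHk; set Z := coflows_vanishing n (e |: S).
have -> : (n.+1 * #|Z| = #|setX [set: 'I_n.+1] Z|)%N by rewrite cardsX cardsT card_ord.
(* Since [v e = 1] and [p.2] vanishes at [e], the value at [e] recovers [p.1]. *)
pose h (p : 'I_n.+1 * {ffun E -> 'I_n.+1}) := [ffun a => p.2 a + p.1 *~ v a].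
have cN (t : 'I_n.+1) C : C \in scircuits N -> csum C (fun a => t *~ v a) = 0.
  by move=> CN; rewrite -(raddf_csum C (intmul t : {additive int -> 'I_n.+1})) vN.
have h_inj : {in setX setT Z &, injective h}.
  move=> [t f] [u g]; rewrite !inE /= => /andP[_ /forall_inP f0] /andP[_ /forall_inP g0] E_h.
  have tu : t = u.
    have := congr1 (fun h : {ffun _} => h e) E_h; rewrite !ffunE ve !mulr1z.
    by rewrite (eqP (f0 e _)) ?(eqP (g0 e _)) ?inE ?eqxx // !add0r.
  rewrite tu in E_h *; congr pair; apply/ffunP => a.
  by have := congr1 (fun h : {ffun _} => h a) E_h; rewrite !ffunE => /addIr.
rewrite -(card_in_imset h_inj); apply: eq_card => f.
rewrite inE; apply/andP/imsetP => [[/coflowP fN /forall_inP f0]|].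
  exists (f e, [ffun a => f a - f e *~ v a]); last first.
    by apply/ffunP => a; rewrite !ffunE subrK.
  rewrite !inE /=; apply/andP; split; last first.
    apply/forall_inP => a; rewrite !inE ffunE => /orP[/eqP->|aS].
      by rewrite ve mulr1z subrr.
    by rewrite v0 // mulr0z subr0 f0.
  apply/coflowP => C CN; rewrite -[RHS](fN C CN).
  rewrite -[LHS]addr0 -(cN (f e) C CN) -csumD; apply: eq_csum => a _.
  by rewrite ffunE subrK.
case=> -[t g]; rewrite !inE /= => /andP[/coflowP gN /forall_inP g0] ->; split.
  apply/coflowP => C CN; rewrite -[RHS](gN C CN) -[RHS]addr0 -(cN t C CN) -csumD.
  by apply: eq_csum => a _; rewrite ffunE.
apply/forall_inP => a aS; rewrite ffunE v0 // mulr0z addr0 g0 //.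
by rewrite !inE aS orbT.
Qed.

End RegularOriented.

(** * Lattice points with given signs *)

Section QuasiPolynomial.

(* The polynomials [x (x - 2) ... (x - 2 (n - 1))] form a basis on which the
   difference operator of step 2 acts as a shift. *)
Lemma step2_antidifference (g : {poly rat}) :
  exists p : {poly rat}, forall x, p.[x + 2%:R] - p.[x] = g.[x].
Proof.
pose r n : {poly rat} := \prod_(i < n) ('X - ((2 * i)%N%:R)%:P).
have rE n x : (r n).[x] = \prod_(i < n) (x - (2 * i)%N%:R).
  by rewrite horner_prod; apply: eq_bigr => i _; rewrite !hornerE.
have r_diff n x : (r n.+1).[x + 2%:R] - (r n.+1).[x] = (2 * n.+1)%N%:R * (r n).[x].
  rewrite !rE big_ord_recl [X in _ - X]big_ord_recr /= muln0 subr0.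
  rewrite (eq_bigr (fun i : 'I_n => x - (2 * i)%N%:R)) => [|i _]; last first.
    by rewrite /bump /= add1n mulnS natrD; ring.
  by rewrite mulnS natrD; ring.
have [n] := ubnP (size g); elim: n g => // n IHn g; rewrite ltnS => gn.
case: n gn IHn => [|n] gn IHn.
  exists 0 => x; move: gn; rewrite leqn0 size_poly_eq0 => /eqP->.
  by rewrite !horner0 subrr.
have r_size : size (r n) = n.+1.
  rewrite /r size_prod_XsubC /index_enum -enumT -cardE card_ord //.
have r_lead : (r n)`_n = 1.
  have /monicP : r n \is monic by apply: monic_prod_XsubC.
  by rewrite /lead_coef r_size.
have [|p pE] := IHn (g - g`_n *: r n).
  rewrite ltnS; apply/leq_sizeP => j; rewrite leq_eqVlt => /orP[/eqP<-|ltj].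
    by rewrite coefB coefZ r_lead mulr1 subrr.
  rewrite coefB coefZ (nth_default _ (leq_trans gn ltj)) (@nth_default _ 0 (r n)) ?mulr0 ?subrr //.
  by rewrite r_size.
exists (p + (g`_n / (2 * n.+1)%N%:R) *: r n.+1) => x.
have nz : (2 * n.+1)%N%:R != 0 :> rat by rewrite pnatr_eq0.
rewrite !hornerD !hornerZ opprD addrACA pE -mulrBr r_diff mulrA divfK //.
by rewrite !hornerE subrK.
Qed.

(** Quasi-polynomials of period 2. The value at 0 is left free: there the facets [x = 0] and [x = q]
    of the cube coincide. *)
Definition quasi_poly (f : nat -> nat) : Prop :=
  exists p : bool -> {poly rat}, forall q, (0 < q)%N -> (f q)%:R = (p (odd q)).[q%:R].

Lemma eq_quasi_poly f g : (forall q, (0 < q)%N -> f q = g q) ->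
  quasi_poly f -> quasi_poly g.
Proof. by move=> fg [p pE]; exists p => q q0; rewrite -fg ?pE. Qed.

Lemma quasi_poly0 : quasi_poly (fun=> 0%N).
Proof. by exists (fun=> 0) => q _; rewrite horner0. Qed.

Lemma quasi_polyD f g : quasi_poly f -> quasi_poly g ->
  quasi_poly (fun q => (f q + g q)%N).
Proof.
move=> [p pE] [r rE]; exists (fun b => p b + r b) => q q0.
by rewrite hornerD natrD pE ?rE.
Qed.

Lemma quasi_poly_sum (I : finType) (P : pred I) (f : I -> nat -> nat) :
  (forall i, P i -> quasi_poly (f i)) -> quasi_poly (fun q => \sum_(i | P i) f i q)%N.
Proof.
move=> fP; have fP' i : exists p : bool -> {poly rat},
    P i -> forall q, (0 < q)%N -> (f i q)%:R = (p (odd q)).[q%:R].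
  by have [/fP[p pE]|] := boolP (P i); [exists p | exists (fun=> 0)].
have [p pE] := choice fP'; exists (fun b => \sum_(i | P i) p i b) => q q0.
by rewrite horner_sum natr_sum; apply: eq_bigr => i Pi; apply: pE.
Qed.

Lemma quasi_polyS f : quasi_poly f -> quasi_poly (fun q => f q.+1).
Proof.
move=> [p pE]; exists (fun b => p (~~ b) \Po ('X + 1)) => q q0.
by rewrite horner_comp !hornerE natr1 pE.
Qed.

(** On each parity class, [f] is an antidifference of [g] up to a constant. *)
Lemma quasi_poly_rec f g : quasi_poly g ->
  (forall q, (0 < q)%N -> f q.+2 = (f q + g q)%N) -> quasi_poly f.
Proof.
move=> [r rE] fg; have [p pE] := choice (fun b => step2_antidifference (r b)).
(* [2 - b] is the least positive integer of parity [b]; the constant adjusts the value there. *)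
pose p' b := p b + ((f (2 - b)%N)%:R - (p b).[(2 - b)%N%:R])%:P.
have p'E b x : (p' b).[x + 2%:R] = (p' b).[x] + (r b).[x].
  by rewrite /p' !hornerD !hornerC -pE; ring.
exists p' => q; have [m] := ubnP q; elim: m q => // m IHm q.
case: q => [//|[|[|q]]] ltq _; [by rewrite /p' hornerD hornerC addrC subrK..|].
rewrite fg // natrD IHm //; last by lia.
by rewrite rE //= negbK -(addn2 q.+1) natrD p'E.
Qed.

End QuasiPolynomial.

(** * Counting lattice points in boxes *)

Section LatticeCount.
Variable E : finType.

(** [P] takes unbounded vectors, so that counts in boxes of different sizes can be compared. *)
Definition lattice_count (k : nat) (P : pred {ffun E -> nat}) : nat :=
  #|[set X : {ffun E -> 'I_k.+1} | P [ffun e => X e : nat]]|.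

(** Translation by [v] is a bijection; the bounds ensure that neither box cuts off a point. *)
Lemma lattice_count_shift k l (P Q : pred {ffun E -> nat}) (v : {ffun E -> nat}) :
  (forall Y e, P Y -> (Y e <= k)%N) -> (forall X e, Q X -> (v e <= X e <= l)%N) ->
  (forall Y : {ffun E -> nat}, P Y = Q [ffun e => Y e + v e]%N) ->
  lattice_count k P = lattice_count l Q.
Proof.
move=> Pk Ql PQ; pose h (Y : {ffun E -> 'I_k.+1}) : {ffun E -> 'I_l.+1} :=
  [ffun e => inord (Y e + v e)].
have hE (Y : {ffun E -> 'I_k.+1}) : P [ffun e => Y e : nat] -> forall e, (h Y e = Y e + v e :> nat)%N.
  move=> PY e; rewrite ffunE inordK // ltnS.
  by move: PY; rewrite PQ => /Ql-/(_ e); rewrite !ffunE => /andP[].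
rewrite /lattice_count -[LHS](@card_in_imset _ _ h) => [|Y Z]; last first.
  rewrite !inE => PY PZ YZ; apply/ffunP => e; apply: val_inj; apply: (@addIn (v e)).
  by rewrite -!hE // YZ.
apply: eq_card => X; rewrite inE; apply/imsetP/idP => [[Y]|QX].
  rewrite inE => PY ->; move: (PY); rewrite PQ; congr Q.
  by apply/ffunP => e; rewrite [LHS]ffunE [RHS]ffunE hE // ffunE.
have vX e : (v e <= X e)%N by have := Ql _ e QX; rewrite ffunE => /andP[].
have PX : P [ffun e => X e - v e]%N.
  by rewrite PQ; move: QX; congr Q; apply/ffunP => e; rewrite !ffunE subnK.
have Xk e : (X e - v e <= k)%N by have := Pk _ e PX; rewrite ffunE.
exists [ffun e => inord (X e - v e)].
  by rewrite inE; move: PX; congr P; apply/ffunP => e; rewrite !ffunE inordK ?ltnS.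
apply/ffunP => e; apply: val_inj; rewrite !ffunE.
rewrite (inordK (_ : X e - v e < k.+1)%N) ?ltnS //.
by rewrite subnK // inord_val.
Qed.

Lemma lattice_count_partition k (I : finType) (P : pred {ffun E -> nat})
    (p : {ffun E -> nat} -> I) (Q : pred I) : (forall X, P X -> Q (p X)) ->
  lattice_count k P = (\sum_(i | Q i) lattice_count k [pred X | P X & p X == i])%N.
Proof.
move=> PQ; rewrite /lattice_count -sum1_card.
rewrite (partition_big (fun X : {ffun E -> 'I_k.+1} => p [ffun e => X e : nat]) Q) /=.
  apply: eq_bigr => i _; rewrite -sum1_card; apply: eq_bigl => X; rewrite !inE.
  by [].
by move=> X; rewrite inE; apply: PQ.
Qed.

Lemma eq_lattice_count k (P Q : pred {ffun E -> nat}) : P =1 Q ->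
  lattice_count k P = lattice_count k Q.
Proof. by move=> PQ; apply: eq_card => X; rewrite !inE PQ. Qed.

End LatticeCount.

(** * Counting coflows with prescribed signs *)

Section CoflowCount.
Variables (R : realType) (E : finType) (N : oriented_matroid E).
Hypothesis regN : oregular R N.

(** A facet is named by the coordinate of the 0/1-vertices on it, so that it can be compared with
    [v e]; [None] is the interior. *)
Definition face (q x : nat) : option bool :=
  if x == 0%N then Some false else if x == q then Some true else None.

(** Translation by [u] sends the facet [u] of level [q] to the facet [u] of level [q + 1], and the
    opposite facet into the interior, hence the merging on the left. *)
Lemma face_add q y (u : bool) (c : option bool) :
  (0 < q)%N -> (c == None) || (c == Some u) ->
  (y <= q)%N && ((if face q y == Some u then face q y else None) == c) =
  (y + u <= q.+1)%N && (face q.+1 (y + u) == c).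
Proof.
move=> q0; rewrite /face; case: u c => [] [[]|] //= _; rewrite ?addn1 ?addn0 ?ltnS ?eqSS.
- by case: (y =P 0%N) => [->|_]; [case: q q0 | case: (y == q)].
- by case: (y =P 0%N) => [->|_]; [case: q q0 | case: (y == q)].
- case: (y =P 0%N) => [->//|_]; case: (y =P q) => [->|_].
    by rewrite andbF (ltn_eqF (ltnSn q)) andbF.
  by case: (y =P q.+1) => [->|_]; rewrite ?andbF.
- case: (y =P 0%N) => [->//|_] /=; case: (y =P q) => [->|ne].
    by rewrite (ltn_eqF (ltnSn q)) leqnn leqnSn.
  case: (y =P q.+1) => [->|ne']; first by rewrite ltnn andbF.
  by rewrite !andbT; lia.
Qed.

Definition bvec (b : {ffun E -> bool}) (e : E) : int := (b e : nat)%:Z.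

(* [s] prescribes an open face of the cube [0, q]^E, [p] the parities, and [b]
   the circuit sums divided by [q]. *)
Definition cell (s : {ffun E -> option bool}) (p b : {ffun E -> bool}) (q : nat) :
    pred {ffun E -> nat} := fun X =>
  [forall e, [&& X e <= q, face q (X e) == s e & odd (X e) == p e]%N]
  && [forall C in scircuits N, csum C (fun e => (X e)%:Z) == q%:Z * csum C (bvec b)].

(** The 0/1-points of the closed face [s] with the circuit sums of [b]. *)
Definition vertex (s : {ffun E -> option bool}) (b v : {ffun E -> bool}) : bool :=
  [forall e, (s e == None) || (s e == Some (v e))]
  && [forall C in scircuits N, csum C (bvec v) == csum C (bvec b)].

(** Rounding [X / q] stays in the unit cube and fixes the coordinates that are already 0 or 1. *)
Lemma cube_point (q : nat) (X : {ffun E -> nat}) (c : signed_set E -> int) :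
  (0 < q)%N -> (forall e, X e <= q)%N ->
  {in scircuits N, forall C, csum C (fun e => (X e)%:Z) = q%:Z * c C} ->
  exists v : {ffun E -> bool}, {in scircuits N, forall C, csum C (bvec v) = c C} /\
    forall e, (X e = 0%N -> v e = false) /\ (X e = q -> v e = true).
Proof.
move=> q0 Xq /(coflow_division regN q0)[v [vc v_rounds]].
have v_ge0 e : 0 <= v e by apply: (v_rounds e 0).2; rewrite mulr0.
have v_le1 e : v e <= 1 by apply: (v_rounds e 1).1; rewrite mulr1 lez_nat.
exists [ffun e => v e == 1]; split=> [C CN|e].
  rewrite -(vc C CN); apply: eq_csum => e _; rewrite /bvec ffunE.
  by have := v_ge0 e; have := v_le1 e; case: eqP => [->//|]; lia.
rewrite ffunE; split=> Xe; [apply/eqP => ve|apply/eqP; apply: le_anti].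
  by have := (v_rounds e 0).1; rewrite Xe mulr0 ve => /(_ isT).
by rewrite v_le1 (v_rounds e 1).2 // mulr1 Xe.
Qed.

Lemma cell_vertex s p b q X : (0 < q)%N -> cell s p b q X -> exists v, vertex s b v.
Proof.
move=> q0 /andP[/forallP Xs /forall_inP Xb].
have [|C CN|v [vb vX]] := @cube_point q X (fun C => csum C (bvec b)) q0.
- by move=> e; have /and3P[] := Xs e.
- exact/eqP/Xb.
exists v; apply/andP; split; last by apply/forall_inP => C CN; apply/eqP/vb.
apply/forallP => e; have /and3P[_ /eqP <- _] := Xs e; rewrite /face.
have [v0 v1] := vX e.
by case: (X e =P 0%N) => [/v0->|_]; last by case: (X e =P q) => [/v1->|].
Qed.

Definition cell_count s p b q := lattice_count q (cell s p b q).

(** The smallest face of the cube containing the face [s] and the vertex [v]. *)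
Definition join_vertex (v : {ffun E -> bool}) (s : {ffun E -> option bool}) :
  {ffun E -> option bool} := [ffun e => if s e == Some (v e) then s e else None].

Definition add_parity (p v : {ffun E -> bool}) : {ffun E -> bool} :=
  [ffun e => p e (+) v e].

(* Subtracting [v] maps a cell at level [q + 1] bijectively to a union of cells at level [q]. *)
Lemma cell_count_rec s p b v q : (0 < q)%N -> vertex s b v ->
  cell_count s p b q.+1 =
  (\sum_(t | join_vertex v t == s) cell_count t (add_parity p v) b q)%N.
Proof.
move=> q0 /andP[/forallP sv /forall_inP vb].
pose faces (Y : {ffun E -> nat}) : {ffun E -> option bool} := [ffun e => face q (Y e)].
(* The points of level [q] whose translate by [v] lies in the cell of level [q + 1]. *)
pose P (Y : {ffun E -> nat}) :=
  [forall e, [&& Y e <= q, join_vertex v (faces Y) e == s e & odd (Y e) == add_parity p v e]%N]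
  && [forall C in scircuits N, csum C (fun e => (Y e)%:Z) == q%:Z * csum C (bvec b)].
transitivity (lattice_count q P).
  apply: esym; apply: (@lattice_count_shift _ _ _ _ _ [ffun e => v e : nat]) => [Y e|X e|Y].
  - by case/andP=> /forallP/(_ e)/and3P[].
  - case/andP=> /forallP/(_ e)/and3P[Xe /eqP sE _] _; rewrite Xe andbT ffunE.
    have := sv e; rewrite -sE /face; case: (X e =P 0%N) => [-> /orP[//|/eqP[<-//]]|/eqP].
    by rewrite -lt0n; case: (v e).
  rewrite /P /cell; congr (_ && _).
    apply: eq_forallb => e; rewrite !ffunE.
    rewrite andbA andbA (face_add _ q0 (sv e)); congr (_ && _).
    by rewrite oddD oddb; case: (odd _) (p e) (v e) => [] [] [].
  apply: eq_forallb => C; case CN: (C \in scircuits N) => //=.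
  have <- : csum C (fun e => (Y e)%:Z) + csum C (bvec v) =
      csum C (fun e => ([ffun e => Y e + [ffun e => v e : nat] e]%N e)%:Z).
    by rewrite -csumD; apply: eq_csum => e _; rewrite /bvec !ffunE PoszD.
  (* [v] has the circuit sums of [b], so adding it raises the factor from [q] to [q + 1]. *)
  by rewrite (eqP (vb C CN)) intS mulrDl mul1r [RHS]eq_sym addrC (inj_eq (addIr _)) eq_sym.
rewrite (@lattice_count_partition _ _ _ _ faces (fun t => join_vertex v t == s)); last first.
  by move=> Y /andP[/forallP Ys _]; apply/eqP/ffunP => e; have /and3P[_ /eqP] := Ys e.
apply: eq_bigr => t /eqP ts; apply: eq_lattice_count => Y /=; rewrite /P /cell.
rewrite andbAC; congr (_ && _); apply/andP/forallP => [[/forallP Ys /eqP <-] e|Yt].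
  by have /and3P[-> _ ->] := Ys e; rewrite ffunE eqxx.
have Yt' : faces Y = t.
  by apply/ffunP => e; rewrite ffunE; have /and3P[_ /eqP] := Yt e.
rewrite Yt' ts; split=> //; apply/forallP => e.
by have /and3P[-> _ ->] := Yt e; rewrite eqxx.
Qed.

(** Induction on the number of free coordinates: in [cell_count_rec], the faces other than [s] have
    fewer of them. Without a vertex all cells are empty. *)
Lemma cell_count_quasi_poly s p b : quasi_poly (cell_count s p b).
Proof.
have [m] := ubnP #|[set e | s e == None]|; elim: m s p => // m IHm s p ltm.
have [/existsP[v vP]|/existsPn nv] := boolP [exists v, vertex s b v]; last first.
  apply: eq_quasi_poly quasi_poly0 => q q0; apply/esym/eqP; rewrite cards_eq0.
  apply/eqP/setP => X; rewrite !inE; apply/negP => /(cell_vertex q0)[v vP].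
  by have := nv v; rewrite vP.
pose lower p q := (\sum_(t | (join_vertex v t == s) && (t != s)) cell_count t p b q)%N.
have lower_qp p' : quasi_poly (lower p').
  apply: quasi_poly_sum => t /andP[/eqP ts nts]; apply: IHm.
  rewrite -ltnS; apply: leq_trans ltm; rewrite ltnS; apply: proper_card.
  apply/properP; split.
    by apply/subsetP => e; rewrite !inE -ts ffunE => /eqP->.
  have /existsP[e se] : [exists e, t e != s e].
    apply: contraNT nts => /existsPn ts'; apply/eqP/ffunP => e.
    by apply/eqP; have := ts' e; rewrite negbK.
  move: se; rewrite -ts ffunE; case: ifP => [_|ve te]; first by rewrite eqxx.
  by exists e; rewrite !inE // ffunE ve.
have rec p' q : (0 < q)%N -> cell_count s p' b q.+1 =
    (cell_count s (add_parity p' v) b q + lower (add_parity p' v) q)%N.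
  move=> q0; rewrite (cell_count_rec _ q0 vP) (bigD1 s) //=.
  apply/eqP/ffunP => e; rewrite ffunE; case/andP: vP => /forallP/(_ e) + _.
  by case/orP => /eqP->; rewrite ?eqxx.
(* Two steps add [v] to the parities twice; the second correction is taken at [q + 1]. *)
apply: (quasi_poly_rec (quasi_polyD (lower_qp p) (quasi_polyS (lower_qp (add_parity p v))))).
move=> q q0; rewrite rec // rec // addnA.
suff -> : add_parity (add_parity p v) v = p by [].
by apply/ffunP => e; rewrite !ffunE -addbA addbb addbF.
Qed.

(** [Some true] stands for negative, so that the sign is the parity of the doubled residue. *)
Definition coflow_sign n (x : 'I_n.+1) : option bool :=
  if x == 0 then None else Some (n.+1./2 < x)%N.

(** Up to half of [q], doubling does not wrap around and gives an even number; beyond, it gives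
    [2 x - q], which is odd. *)
Lemma ord_doubleE n (x : 'I_n.+1) : odd n.+1 ->
  (x *+ 2 == 0) = (x == 0) /\ odd (x *+ 2 : 'I_n.+1) = (n.+1./2 < x)%N.
Proof.
move=> odd_n; have xE : (x *+ 2 : 'I_n.+1) = ((x * 2) %% n.+1)%N :> nat by rewrite Zp_mulrn.
have ltx := ltn_ord x; have nE : n.+1 = (n.+1./2.*2).+1 by rewrite -[LHS]odd_double_half odd_n.
have -> : (x *+ 2 == 0) = ((x * 2) %% n.+1 == 0)%N by rewrite -xE.
have -> : (x == 0) = (x == 0 :> nat)%N by [].
rewrite xE; set k := n.+1./2 in nE *.
have [lekx|ltkx] := leqP x k.
  by rewrite modn_small ?muln2 ?odd_double ?double_eq0 //; lia.
have -> : (x * 2 = n.+1 + (x * 2 - n.+1))%N by lia.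
rewrite modnDl modn_small; last by lia.
by split; lia.
Qed.

Lemma double_coflow n (f : {ffun E -> 'I_n.+1}) : odd n.+1 ->
  coflow N [ffun e => f e *+ 2] = coflow N f.
Proof.
move=> odd_n; rewrite !coflowE; apply: eq_forallb => C; congr (_ ==> _).
rewrite -(ord_doubleE (csum C f) odd_n).1; congr (_ == 0).
rewrite mulr2n -csumD; apply: eq_csum => e _; by rewrite ffunE mulr2n.
Qed.

Lemma csum_ord n C (f : E -> 'I_n.+1) :
  (csum C f == 0) = (n.+1 %| csum C (fun e => (f e)%:Z))%Z.
Proof.
have fE e : f e = Zp1 *~ (f e)%:Z.
  by apply: val_inj; rewrite /= -pmulrn Zp_mulrn /= modnMml mul1n modn_small.
rewrite (eq_csum (w' := fun e => Zp1 *~ (f e)%:Z)) => [|e _]; last exact: fE.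
rewrite -(raddf_csum C (intmul Zp1 : {additive int -> 'I_n.+1})) /=.
have natE k : ((Zp1 : 'I_n.+1) *~ k%:Z == 0) = (n.+1 %| k)%N.
  by rewrite -pmulrn Zp_mulrn -val_eqE /= modnMml mul1n.
case: (csum C _) => k; first exact: natE.
by rewrite NegzE mulrNz oppr_eq0 natE dvdzE abszN.
Qed.

(* Doubling maps the coflows modulo an odd [q] bijectively to themselves, and turns
   their signs into the parities of the representatives in [0, q - 1]. *)
Lemma signed_coflow_count_poly (t : {ffun E -> option bool}) : exists p : {poly rat},
  forall n, odd n.+1 ->
  #|[set f : {ffun E -> 'I_n.+1} | coflow N f & [forall e, coflow_sign (f e) == t e]]|%:R
    = p.[n.+1%:R].
Proof.
(* Zero residues lie on the facet 0, the others in the interior, as residues stay below [q]. *)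
pose s : {ffun E -> option bool} := [ffun e => if t e is None then Some false else None].
pose p : {ffun E -> bool} := [ffun e => t e == Some true].
pose b0 : {ffun E -> bool} := [ffun=> false].
(* A 0/1-vector whose circuit sums are those of [v] divided by [q]. The choice depends only on these
   sums, so the canonical vectors list each family of sums once. *)
pose rep (v : E -> int) (q : nat) := odflt b0 [pick b |
  [forall C in scircuits N, csum C v == q%:Z * csum C (bvec b)]].
pose canonical b := rep (bvec b) 1 == b.
have [r rE] := choice (fun b => cell_count_quasi_poly s p b).
exists (\sum_(b | canonical b) r b true) => n odd_n.
pose P (X : {ffun E -> nat}) :=
  [forall e, [&& X e <= n.+1, face n.+1 (X e) == s e & odd (X e) == p e]%N]
  && [forall C in scircuits N, n.+1 %| csum C (fun e => (X e)%:Z)]%Z.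
have PX X : P X -> forall e, (X e <= n)%N.
  case/andP=> /forallP Xs _ e; have /and3P[leX /eqP sE _] := Xs e.
  rewrite -ltnS ltn_neqAle leX andbT; apply: contra_eqN sE => /eqP->.
  by rewrite /face eqxx /= ffunE; case: (t e).
have -> : #|[set f : {ffun E -> 'I_n.+1} | coflow N f & [forall e, coflow_sign (f e) == t e]]|
    = lattice_count n P.
  rewrite -sum1_card /lattice_count -[RHS]sum1_card.
  pose h (f : {ffun E -> 'I_n.+1}) : {ffun E -> 'I_n.+1} := [ffun e => f e *+ 2].
  have h_inj : injective h.
    move=> f g fg; apply/ffunP => e; apply/eqP; rewrite -subr_eq0.
    rewrite -(ord_doubleE _ odd_n).1 mulrnBl subr_eq0.
    by have := congr1 (fun h : {ffun _} => h e) fg; rewrite !ffunE => ->.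
  rewrite [RHS](reindex_inj h_inj) /=.
  apply: eq_bigl => f; rewrite !inE /P andbC; congr (_ && _).
    apply: eq_forallb => e; rewrite !ffunE.
    have [] := ord_doubleE (f e) odd_n; move: (f e *+ 2) => y z o.
    rewrite o /face -[(y == 0 :> nat)%N]/(y == 0) z (ltn_eqF (ltn_ord y)).
    rewrite (ltnW (ltn_ord y)) /coflow_sign; case: (f e =P 0) => [->|_] /=.
      by case: (t e) => [[]|].
    by case: (t e) => [[]|]; case: (_ < _)%N.
  rewrite -(double_coflow f odd_n) coflowE; apply: eq_forallb => C.
  rewrite csum_ord; congr (_ ==> (_ %| _)%Z); apply: eq_csum => e _.
  by rewrite ffunE.
(* Cells of level [q] are counted in [[0, q]], residues in [[0, q - 1]]; [s] excludes the facet
   [q]. *)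
have -> : lattice_count n P = lattice_count n.+1 P.
  apply: (@lattice_count_shift _ _ _ _ _ [ffun=> 0%N]) => [|X e PX'|Y].
  - by move=> Y e /PX/(_ e).
  - by rewrite ffunE leq0n leqW ?PX.
  - by congr P; apply/ffunP => e; rewrite !ffunE addn0.
have repE v q (b : {ffun E -> bool}) : (0 < q)%N ->
    {in scircuits N, forall C, csum C v = q%:Z * csum C (bvec b)} ->
    rep v q = rep (bvec b) 1.
  move=> q0 vb; congr odflt; apply: eq_pick => b' /=; apply: eq_forallb => C.
  case CN: (C \in scircuits N) => //=; rewrite vb // mul1r.
  by rewrite (inj_eq (mulfI _)) // -lt0n.
have repP v q : (exists b, {in scircuits N, forall C, csum C v = q%:Z * csum C (bvec b)}) ->
    {in scircuits N, forall C, csum C v = q%:Z * csum C (bvec (rep v q))}.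
  rewrite /rep => -[b vb]; case: pickP => [b' /forall_inP vb' C CN|/(_ b)/negP[]].
    by apply/eqP/vb'.
  by apply/forall_inP => C CN; apply/eqP/vb.
have vertexP X : P X -> exists b, {in scircuits N, forall C,
    csum C (fun e => (X e)%:Z) = n.+1%:Z * csum C (bvec b)}.
  case/andP=> /forallP Xs /forall_inP XN.
  have [|C CN|b [bN _]] := @cube_point n.+1 X
      (fun C => (csum C (fun e => (X e)%:Z) %/ n.+1)%Z) isT.
  - by move=> e; have /and3P[] := Xs e.
  - by rewrite mulrC divzK // XN.
  - by exists b => C CN; rewrite bN // mulrC divzK // XN.
rewrite (@lattice_count_partition _ _ _ _ (fun X => rep (fun e => (X e)%:Z) n.+1) canonical).
  rewrite natr_sum horner_sum; apply: eq_bigr => b /eqP can_b.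
  have := rE b n.+1 isT; rewrite odd_n => <-; congr (_ *+ _).
  apply: eq_lattice_count => X /=; apply/andP/andP => [[PX' /eqP repX]|[Xs /forall_inP Xb]].
    have := PX'; case/andP => Xs _; split=> //; apply/forall_inP => C CN; apply/eqP.
    by rewrite -repX; apply: (repP _ _ (vertexP X PX')).
  split; last by apply/eqP; rewrite -[RHS]can_b; apply: repE => // C CN; apply/eqP/Xb.
  apply/andP; split=> //; apply/forall_inP => C CN.
  by rewrite (eqP (Xb C CN)) dvdz_mulr.
move=> X /vertexP/repP XN; rewrite /canonical; apply/eqP; apply: esym.
exact: (repE _ n.+1).
Qed.

End CoflowCount.

(** * Specializing polynomials *)

Section Specialization.

Lemma tnth_yz (x : {mpoly rat[3]}) (i : 'I_3) :
  tnth [tuple x; vy; vz] i = if i == 0 then x else 'X_i.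
Proof.
rewrite (tnth_nth 0); case: i => -[|[|[|//]]] ltn //=;
  by rewrite -val_eqE /= /vy /vz; congr 'X_(_); apply: val_inj.
Qed.

Lemma comp_id_yz (P : {mpoly rat[3]}) : P \mPo [tuple vq; vy; vz] = P.
Proof.
rewrite -[RHS]comp_mpoly_id; congr (_ \mPo _); apply: eq_from_tnth => i.
rewrite tnth_yz tnth_mktuple; case: eqP => // ->.
by rewrite /vq; congr 'X_(_); apply: val_inj.
Qed.

(** [P] is viewed as a univariate polynomial in [q] with coefficients in [y] and [z], so that roots
    can be counted. *)
Lemma horner_yz (P : {mpoly rat[3]}) (x : {mpoly rat[3]}) :
  (mmap (polyC \o @mpolyC 3 rat) (fun i : 'I_3 => if i == 0 then 'X else ('X_i)%:P) P).[x]
    = P \mPo [tuple x; vy; vz].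
Proof.
rewrite /comp_mpoly /mmap horner_sum; apply: eq_bigr => m _.
rewrite hornerM hornerC; congr (_ * _); rewrite /mmap1 horner_prod.
apply: eq_bigr => i _; rewrite horner_exp tnth_yz.
by case: ifP; rewrite ?hornerX ?hornerC.
Qed.

Lemma mpoly_natr_inj : injective (fun k : nat => k%:R : {mpoly rat[3]}).
Proof.
move=> a b /(congr1 (meval (fun=> 0))); rewrite !rmorph_nat => /eqP.
by rewrite eqr_nat => /eqP.
Qed.

(** As a polynomial in [q], the difference has more roots among the odd integers than its degree. *)
Lemma eq_mpoly_odd (P Q : {mpoly rat[3]}) :
  (forall n, odd n.+1 -> P \mPo [tuple n.+1%:R; vy; vz] = Q \mPo [tuple n.+1%:R; vy; vz]) ->
  P = Q.
Proof.
move=> PQ; apply/eqP; rewrite -subr_eq0; apply/eqP; rewrite -[LHS]comp_id_yz -horner_yz.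
set D := mmap _ _ _; suff -> : D = 0 by rewrite horner0.
apply/eqP/negPn/negP => D0.
pose rs : seq {mpoly rat[3]} := [seq (i.*2.+1)%:R | i <- iota 0 (size D)].
have rs_uniq : uniq rs.
  by rewrite map_inj_uniq ?iota_uniq // => i j /mpoly_natr_inj[] /double_inj.
have rs_root : all (root D) rs.
  apply/allP => _ /mapP[i _ ->].
  by rewrite /root horner_yz raddfB /= PQ ?subrr //= odd_double.
by have := max_poly_roots D0 rs_root rs_uniq; rewrite size_map size_iota ltnn.
Qed.

Lemma comp_mpolyA (P : {mpoly rat[3]}) (l1 l2 : 3.-tuple {mpoly rat[3]}) :
  (P \mPo l1) \mPo l2 = P \mPo [tuple of map (comp_mpoly l2) l1].
Proof.
rewrite [P \mPo l1]comp_mpolyE [RHS]comp_mpolyE raddf_sum /=; apply: eq_bigr => m _.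
rewrite comp_mpolyZ rmorph_prod; congr (_ *: _); apply: eq_bigr => i _ /=.
by rewrite rmorphXn tnth_map.
Qed.

Lemma A_polynomialP (A : finType) (N : oriented_matroid A) :
  (exists P, is_A_polynomial N P) -> is_A_polynomial N (A_polynomial N).
Proof. exact: classical_sets.xgetPex. Qed.

Lemma A_polynomial_unique (A : finType) (N : oriented_matroid A) P :
  is_A_polynomial N P -> A_polynomial N = P.
Proof.
move=> NP; apply: eq_mpoly_odd => n odd_n.
by rewrite NP // (A_polynomialP (ex_intro _ P NP)).
Qed.

Lemma comp_yz_q x : vq \mPo [tuple x; vy; vz] = x.
Proof. by rewrite comp_mpolyXU. Qed.
Lemma comp_yz_y x : vy \mPo [tuple x; vy; vz] = vy.
Proof. by rewrite comp_mpolyXU. Qed.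
Lemma comp_yz_z x : vz \mPo [tuple x; vy; vz] = vz.
Proof. by rewrite comp_mpolyXU. Qed.

End Specialization.

(** * Subset expansion of the Potts polynomial *)

Section Potts.
Variables (E : finType) (M : matroid E).

Lemma leq_rk_card (S : {set E}) : (rk M S <= #|S|)%N.
Proof. by apply/bigmax_leqP => I /andP[IS _]; apply: subset_leq_card. Qed.

(** With [t = 1 / y - 1], the powers of [t] combine to [t ^+ #|S|], and [y * t = 1 - y]. *)
Lemma potts_expansion (K : fieldType) (q y : K) : y != 0 -> y != 1 ->
  potts M q y =
  \sum_(S : {set E}) q ^+ (rk M setT - rk M S) * ((1 - y) ^+ #|S| * y ^+ (#|E| - #|S|)).
Proof.
move=> y0 y1; rewrite /potts /tutte mulr_sumr; apply: eq_bigr => S _.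
have sr : (rk M S <= rk M setT)%N by apply: rkS.
have t0 : 1 / y - 1 != 0 by rewrite subr_eq0 div1r -invr1 (inj_eq invr_inj).
rewrite [1 + _]addrC addrK; set t := 1 / y - 1 in t0 *.
have yt : y * t = 1 - y by rewrite /t mulrBr mulr1 mulrCA divff // mulr1.
rewrite -yt !exprMn exprVn.
have -> : #|E| = (#|S| + (#|E| - #|S|))%N by rewrite subnKC // max_card.
rewrite addKn exprD.
have -> : t ^+ rk M setT = t ^+ (rk M setT - rk M S) * t ^+ rk M S by rewrite -exprD subnK.
have -> : t ^+ #|S| = t ^+ (#|S| - rk M S) * t ^+ rk M S by rewrite -exprD subnK // leq_rk_card.
have: t ^+ (rk M setT - rk M S) != 0 by rewrite expf_neq0.
move: (t ^+ (rk M setT - _)) (t ^+ rk M S) (t ^+ (#|S| - _)) (q ^+ _) (y ^+ #|S|) (y ^+ (_ - _)).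
by move=> u v w x a b u0; field.
Qed.

(** The expansion has no denominators, so it can be compared with A-polynomials before passing to
    fractions. *)
Definition potts_mpoly (w : {mpoly rat[3]}) : {mpoly rat[3]} :=
  \sum_(S : {set E}) vq ^+ (rk M setT - rk M S) * ((1 - w) ^+ #|S| * w ^+ (#|E| - #|S|)).

Lemma potts_mpolyE (w : {mpoly rat[3]}) : w != 0 -> w != 1 ->
  potts M (tofrac vq) (tofrac w) = tofrac (potts_mpoly w).
Proof.
move=> w0 w1; rewrite potts_expansion ?tofrac_eq0 //; last first.
  by rewrite -tofrac1 tofrac_eq.
rewrite /potts_mpoly raddf_sum; apply: eq_bigr => S _ /=.
by rewrite !tofracM !tofracXn tofracB tofrac1.
Qed.

Lemma potts_mpoly_comp w x : w \mPo [tuple x; vy; vz] = w ->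
  potts_mpoly w \mPo [tuple x; vy; vz] =
  \sum_(S : {set E}) x ^+ (rk M setT - rk M S) * ((1 - w) ^+ #|S| * w ^+ (#|E| - #|S|)).
Proof.
move=> wx; rewrite raddf_sum /=; apply: eq_bigr => S _.
by rewrite !rmorphM /= !rmorphXn /= comp_yz_q rmorphB /= comp_mpoly1 wx.
Qed.

End Potts.

(** * Weighted sums over coflows *)

Section Signs.

Definition sign_weight (s : option bool) : {mpoly rat[3]} :=
  if s is Some b then if b then vz else vy else 1.

Lemma coflow_sign_pos n (x : 'I_n.+1) :
  (0 < x <= n.+1./2)%N = (coflow_sign x == Some false).
Proof.
rewrite /coflow_sign lt0n -[(x == 0 :> nat)%N]/(x == 0); case: eqP => //= _.
by rewrite leqNgt; case: (_ < _)%N.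
Qed.

Lemma coflow_sign_opp n (x : 'I_n.+1) : odd n.+1 ->
  coflow_sign (- x) = omap negb (coflow_sign x).
Proof.
move=> odd_n; rewrite /coflow_sign oppr_eq0; case: eqP => //= /eqP x0; congr Some.
have ltx := ltn_ord x; have nE : n.+1 = (n.+1./2.*2).+1 by rewrite -[LHS]odd_double_half odd_n.
have {}x0 : (0 < x)%N by rewrite lt0n.
by rewrite modn_small; lia.
Qed.

Lemma coflow_sign_neg n (x : 'I_n.+1) : odd n.+1 ->
  (0 < (- x)%R <= n.+1./2)%N = (coflow_sign x == Some true).
Proof.
by move=> odd_n; rewrite coflow_sign_pos coflow_sign_opp //; case: coflow_sign => [[]|].
Qed.

Lemma coflow_weightE (A : finType) n (f : {ffun A -> 'I_n.+1}) : odd n.+1 ->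
  vy ^+ #|pos_set f| * vz ^+ #|neg_set f| = \prod_a sign_weight (coflow_sign (f a)).
Proof.
move=> odd_n; rewrite -!prodr_const [X in X * _]big_mkcond [X in _ * X]big_mkcond.
rewrite -big_split; apply: eq_bigr => a _ /=.
rewrite !inE coflow_sign_pos coflow_sign_neg //.
by case: coflow_sign => [[]|] /=; rewrite ?mulr1 ?mul1r.
Qed.

End Signs.

Section CoflowSums.
Variables (R : realType) (E : finType) (N : oriented_matroid E).
Hypothesis regN : oregular R N.

(** Each factor is [w] plus a term, [1 - w] or 0, that survives only where [f] vanishes. After
    expansion over subsets [S], [card_coflows_vanishing] counts the coflows vanishing on [S]. *)
Lemma coflow_support_sum n (w : {mpoly rat[3]}) :
  w \mPo [tuple n.+1%:R; vy; vz] = w ->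
  \sum_(f : {ffun E -> 'I_n.+1} | coflow N f) \prod_e (if f e == 0 then 1 else w)
  = potts_mpoly (underlying N) w \mPo [tuple n.+1%:R; vy; vz].
Proof.
move=> /potts_mpoly_comp ->.
transitivity (\sum_(f : {ffun E -> 'I_n.+1} | coflow N f) \sum_(S : {set E})
    \prod_e (if e \in S then (if f e == 0 then 1 - w else 0) else w)).
  apply: eq_bigr => f _; rewrite -bigA_distr /=; apply: eq_bigr => e _.
  by case: eqP => _; rewrite ?subrK ?add0r.
rewrite exchange_big; apply: eq_bigr => S _ /=.
rewrite -natrX -(card_coflows_vanishing regN) -sum1_card natr_sum mulr_suml.
rewrite [RHS](eq_bigl (fun f => coflow N f && [forall e in S, f e == 0])) => [|f]; last first.
  by rewrite inE.
rewrite big_mkcondr; apply: eq_bigr => f _; case: ifP => [/forall_inP f0|/negbT].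
  rewrite mul1r (bigID (mem S)) /=; congr (_ * _).
    by rewrite -prodr_const; apply: eq_bigr => e eS; rewrite eS f0.
  have -> : (#|E| - #|S|)%N = #|~: S| by rewrite [RHS]cardsCs setCK.
  rewrite -prodr_const; apply: eq_big => [e|e /negPf->//].
  by rewrite inE.
by case/forall_inPn => e eS /negPf fe; rewrite (bigD1 e) //= eS fe mul0r.
Qed.

(** Coflows are grouped by sign pattern: each pattern has a fixed weight, free of [q], and a count
    polynomial in odd [q]. *)
Lemma weighted_coflow_sum (wt : E -> option bool -> {mpoly rat[3]}) :
  (forall n e s, wt e s \mPo [tuple n.+1%:R; vy; vz] = wt e s) ->
  exists P : {mpoly rat[3]}, forall n, odd n.+1 -> P \mPo [tuple n.+1%:R; vy; vz] =
    \sum_(f : {ffun E -> 'I_n.+1} | coflow N f) \prod_e wt e (coflow_sign (f e)).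
Proof.
move=> wtE; have [p pE] := choice (signed_coflow_count_poly regN).
exists (\sum_t (map_poly (@mpolyC 3 rat) (p t)).[vq] * \prod_e wt e (t e)) => n odd_n.
rewrite (partition_big (fun f : {ffun E -> 'I_n.+1} => [ffun e => coflow_sign (f e)]) predT) //=.
rewrite raddf_sum; apply: eq_bigr => t _ /=; rewrite rmorphM rmorph_prod /=.
under eq_bigr do rewrite wtE.
transitivity ((p t).[n.+1%:R]%:MP * \prod_e wt e (t e)).
  congr (_ * _); rewrite -horner_map -map_poly_comp /= comp_yz_q.
  rewrite -[n.+1%:R]mpolyC_nat -horner_map; congr (_.[_]).
  by apply: eq_map_poly => c /=; rewrite comp_mpolyC.
rewrite -pE // mpolyC_nat -sum1_card natr_sum mulr_suml.
apply: eq_big => [f|f].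
  rewrite inE; congr (_ && _); apply/forallP/eqP => [ft|<- e]; last by rewrite ffunE.
  by apply/ffunP => e; rewrite ffunE; apply/eqP.
rewrite inE => /andP[_ /forallP ft]; rewrite mul1r.
by apply: eq_bigr => e _; rewrite (eqP (ft e)).
Qed.

End CoflowSums.

(** * Doubles and orientations *)

Section Double.
Variables (E : finType) (N : oriented_matroid E).

Lemma csumE (A : finType) (V : zmodType) (C : signed_set A) (w : A -> V) :
  csum C w = \sum_a ((if a \in C.1 then w a else 0) - (if a \in C.2 then w a else 0)).
Proof. by rewrite sumrB -!big_mkcond. Qed.

Lemma csum_lift (V : zmodType) s C (g : E * bool -> V) :
  csum (Defs.lift s C) g = csum C (fun e => if s e then - g (e, true) else g (e, false)).
Proof.
pose G x := (if x \in (Defs.lift s C).1 then g x else 0) - (if x \in (Defs.lift s C).2 then g x else 0).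
rewrite !csumE; transitivity (\sum_e \sum_b G (e, b)).
  by rewrite pair_bigA; apply: eq_bigr => -[e b].
apply: eq_bigr => e _; rewrite big_bool /G !inE /=.
case: (s e) => /=; rewrite subrr ?add0r ?addr0 //.
by case: (e \in C.1); case: (e \in C.2); rewrite ?subr0 ?sub0r ?opprK ?oppr0 // addrC.
Qed.

Lemma csum_digon (V : zmodType) e (g : E * bool -> V) :
  csum (digon e true) g = g (e, true) + g (e, false).
Proof.
rewrite /csum big_set0 subr0 /=.
have -> : [set x : E * bool | x.1 == e] = [set (e, true); (e, false)].
  by apply/setP => -[f []]; rewrite !inE !xpair_eqE ?andbT ?andbF ?orbF.
by rewrite big_setU1 ?big_set1 // inE xpair_eqE andbF.
Qed.

Definition antisymmetric_ext n (f : E -> 'I_n.+1) (x : E * bool) : 'I_n.+1 :=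
  if x.2 then - f x.1 else f x.1.

Lemma csum_lift_ext n s C (f : E -> 'I_n.+1) :
  csum (Defs.lift s C) (antisymmetric_ext f) = csum C f.
Proof.
by rewrite csum_lift; apply: eq_csum => e _; rewrite /antisymmetric_ext /= opprK if_same.
Qed.

(** The digon on [e] gives the relation. A loop has no digon, but both of its copies are loops,
    where coflows vanish. *)
Lemma coflow_double_opp n (g : {ffun E * bool -> 'I_n.+1}) e :
  coflow (opposite_double N) g -> g (e, true) = - g (e, false).
Proof.
move/coflowP => gN; have [Le|Le] := boolP (loop N e).
  have ge b : (if b then - g (e, true) else g (e, false)) = 0.
    have /gN : Defs.lift [ffun=> b] ([set e], set0) \in scircuits (opposite_double N).
      by apply/doubleP; apply: DoubleLift Le _.
    by rewrite csum_lift /csum /= big_set1 big_set0 subr0 ffunE.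
  by have := ge true; have /= -> := ge false => /eqP; rewrite oppr0 oppr_eq0 => /eqP.
have /gN : digon e true \in scircuits (opposite_double N).
  by apply/doubleP; apply: DoubleDigon Le _.
by rewrite csum_digon => /eqP; rewrite addr_eq0 => /eqP.
Qed.

Lemma coflow_double_ext n (f : E -> 'I_n.+1) :
  coflow (opposite_double N) [ffun x => antisymmetric_ext f x] = coflow N [ffun e => f e].
Proof.
apply/coflowP/coflowP => fN C.
  move=> CN; have /fN : Defs.lift [ffun=> false] C \in scircuits (opposite_double N).
    by apply/doubleP; apply: DoubleLift CN _.
  rewrite (eq_csum (w' := antisymmetric_ext f)) => [|x _]; last by rewrite ffunE.
  by rewrite csum_lift_ext; apply: etrans; apply: eq_csum => e _; rewrite ffunE.
rewrite (eq_csum (w' := antisymmetric_ext f)) => [|x _]; last by rewrite ffunE.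
case/doubleP => [e b _ ->|s D DN ->]; last first.
  by rewrite csum_lift_ext -(fN D DN); apply: eq_csum => e _; rewrite ffunE.
case: b; last rewrite -[digon e false]/(sopp (digon e true)) csum_sopp.
all: by rewrite csum_digon /antisymmetric_ext /= addNr ?oppr0.
Qed.

(** Coflows of the double are the antisymmetric extensions of those of [N]; each nonzero value
    contributes one [y] and one [z]. *)
Lemma double_coflow_sum n : odd n.+1 ->
  \sum_(g : {ffun E * bool -> 'I_n.+1} | coflow (opposite_double N) g)
    vy ^+ #|pos_set g| * vz ^+ #|neg_set g|
  = \sum_(f : {ffun E -> 'I_n.+1} | coflow N f) \prod_e (if f e == 0 then 1 else vy * vz).
Proof.
move=> odd_n; pose h (f : {ffun E -> 'I_n.+1}) := [ffun x => antisymmetric_ext f x].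
pose h' (g : {ffun E * bool -> 'I_n.+1}) := [ffun e => g (e, false)].
rewrite (reindex_onto h h') => [|g gN]; last first.
  apply/ffunP => -[e b]; rewrite !ffunE /antisymmetric_ext /= ffunE.
  by case: b; rewrite ?(coflow_double_opp _ gN).
have hK f : h' (h f) = f by apply/ffunP => e; rewrite !ffunE.
apply: eq_big => [f|f _].
  rewrite hK eqxx andbT coflow_double_ext; congr (coflow N _).
  by apply/ffunP => e; rewrite ffunE.
rewrite coflow_weightE //.
transitivity (\prod_e \prod_b sign_weight (coflow_sign (h f (e, b)))).
  by rewrite pair_bigA; apply: eq_bigr => -[e b].
apply: eq_bigr => e _; rewrite big_bool !ffunE /antisymmetric_ext /= coflow_sign_opp //.
rewrite /coflow_sign; case: eqP => _ /=; first by rewrite mulr1.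
by case: (_ < _)%N => //=; rewrite mulrC.
Qed.

End Double.

(** * Coflows of the reorientations *)

Section Orient.
Variables (E : finType) (N : oriented_matroid E) (s : {ffun E -> bool}).

Let deleted := [set (e, s e) | e in E].

Lemma deletedE x : (x \in deleted) = (x.2 == s x.1).
Proof.
apply/imsetP/eqP => [[e _ ->//]|xs]; exists x.1 => //.
by rewrite -xs -surjective_pairing.
Qed.

Lemma kept_proof e : (e, ~~ s e) \notin deleted.
Proof. by rewrite deletedE /=; case: (s e). Qed.

Definition kept e : {x : E * bool | x \notin deleted} :=
  exist (fun x => x \notin deleted) _ (kept_proof e).

Lemma keptK : cancel kept (fun x => (val x).1).
Proof. by []. Qed.

Lemma kept_surj : cancel (fun x : {x : E * bool | x \notin deleted} => (val x).1) kept.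
Proof.
move=> [[e b] xP]; apply: val_inj => /=; congr pair.
by move: xP; rewrite deletedE /=; case: b (s e) => [] [].
Qed.

Lemma csum_emb (A : finType) (D : {set A}) (V : zmodType)
    (X : signed_set {a : A | a \notin D}) (g : A -> V) :
  csum (emb X) g = csum X (g \o val).
Proof.
by rewrite /csum !big_imset //= => x y _ _; apply: val_inj.
Qed.

Lemma coflow_orient_ext n (f : E -> 'I_n.+1) :
  coflow (orient N s) [ffun x => antisymmetric_ext f (val x)] = coflow N [ffun e => f e].
Proof.
apply/coflowP/coflowP => fN C.
  (* [t] selects the copies that are kept. *)
  move=> CN; pose t : {ffun E -> bool} := [ffun e => ~~ s e].
  pose X : signed_set {x : E * bool | x \notin deleted} :=
    (val @^-1: (Defs.lift t C).1, val @^-1: (Defs.lift t C).2).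
  have EX : emb X = Defs.lift t C.
    have im (S : {set E * bool}) : {in S, forall x, x.2 = t x.1} ->
        [set val y | y in (val @^-1: S : {set {x : E * bool | x \notin deleted}})] = S.
      move=> St; apply/setP => x; apply/imsetP/idP => [[y]|xS]; first by rewrite inE => yS ->.
      have xP : x \notin deleted by rewrite deletedE St // ffunE; case: (s _).
      by exists (exist (fun x => x \notin deleted) x xP); rewrite ?inE.
    by rewrite /emb /X /= !im // => x; rewrite inE => /andP[/eqP].
  have /fN : X \in scircuits (orient N s).
    by rewrite inE EX; apply/doubleP; apply: DoubleLift CN _.
  rewrite (eq_csum (w' := antisymmetric_ext f \o val)) => [|x _]; last by rewrite ffunE.
  rewrite -csum_emb EX csum_lift_ext; apply: etrans.
  by apply: eq_csum => e _; rewrite ffunE.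
rewrite (eq_csum (w' := antisymmetric_ext f \o val)) => [|x _]; last by rewrite ffunE.
rewrite -csum_emb inE => /doubleP[e b _ CE|t D DN ->]; last first.
  by rewrite csum_lift_ext -(fN D DN); apply: eq_csum => e _; rewrite ffunE.
(* A digon on [e] contains the deleted copy [(e, s e)]. *)
have := mem_ssupp_digon e b (e, s e); rewrite -CE ssupp_emb eqxx => /imsetP[[x xP] _ /= Ex].
by rewrite -Ex deletedE eqxx in xP.
Qed.

(** The kept copy is [(e, ~~ s e)], where the extension of [f] is [f e] or its opposite. *)
Lemma orient_coflow_sum n : odd n.+1 ->
  \sum_(g : {ffun _ -> 'I_n.+1} | coflow (orient N s) g)
    vy ^+ #|pos_set g| * vz ^+ #|neg_set g|
  = \sum_(f : {ffun E -> 'I_n.+1} | coflow N f)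
      \prod_e sign_weight (if s e then coflow_sign (f e) else omap negb (coflow_sign (f e))).
Proof.
move=> odd_n.
pose h (f : {ffun E -> 'I_n.+1}) : {ffun {x : E * bool | x \notin deleted} -> 'I_n.+1} :=
  [ffun x => antisymmetric_ext f (val x)].
pose h' (g : {ffun {x : E * bool | x \notin deleted} -> 'I_n.+1}) : {ffun E -> 'I_n.+1} :=
  [ffun e => if s e then g (kept e) else - g (kept e)].
rewrite (reindex_onto h h') => [|g gN]; last first.
  apply/ffunP => x; rewrite -[x]kept_surj; move: (val x).1 => e.
  by rewrite !ffunE /antisymmetric_ext /= ffunE; case: (s e); rewrite /= ?opprK.
have hK f : h' (h f) = f.
  by apply/ffunP => e; rewrite !ffunE /antisymmetric_ext /=; case: (s e); rewrite //= opprK.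
apply: eq_big => [f|f _].
  rewrite hK eqxx andbT coflow_orient_ext; congr (coflow N _).
  by apply/ffunP => e; rewrite ffunE.
rewrite coflow_weightE // (reindex kept) /=; last first.
  by exists (fun x => (val x).1) => x _; rewrite ?keptK ?kept_surj.
apply: eq_bigr => e _; rewrite ffunE /antisymmetric_ext /=.
by case: (s e) => //=; rewrite coflow_sign_opp.
Qed.

End Orient.

(** * A-polynomials *)

Section APolynomials.
Variables (R : realType) (E : finType) (N : oriented_matroid E).
Hypothesis regN : oregular R N.

Definition half_yz : {mpoly rat[3]} := 2%:R^-1 *: (vy + vz).

Lemma half_yz2 : half_yz *+ 2 = vy + vz.
Proof. by rewrite /half_yz -scaler_nat scalerA divff // scale1r. Qed.

(** This supplies the conditions of [potts_mpolyE] for each weight to be substituted. *)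
Lemma meval_neq (w : {mpoly rat[3]}) :
  w.@[fun=> 0] = 0 -> w.@[fun=> 1] = 1 -> (w != 0) /\ (w != 1).
Proof.
move=> w0 w1; split; apply/eqP => wE.
  by move: w1; rewrite wE meval0 => /eqP; rewrite eq_sym oner_eq0.
by move: w0; rewrite wE meval1 => /eqP; rewrite oner_eq0.
Qed.

Lemma sign_weight_comp n s : sign_weight s \mPo [tuple n.+1%:R; vy; vz] = sign_weight s.
Proof. by case: s => [[]|]; rewrite /= ?comp_yz_y ?comp_yz_z ?comp_mpoly1. Qed.

Lemma A_polynomial_double :
  A_polynomial (opposite_double N) = potts_mpoly (underlying N) (vy * vz).
Proof.
apply: A_polynomial_unique => n odd_n.
rewrite double_coflow_sum // (coflow_support_sum regN) //.
by rewrite rmorphM /= comp_yz_y comp_yz_z.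
Qed.

(** The A-polynomial exists because its values are weighted coflow sums of [N] itself. *)
Lemma A_polynomial_orient s n : odd n.+1 ->
  A_polynomial (orient N s) \mPo [tuple n.+1%:R; vy; vz] =
    \sum_(f : {ffun E -> 'I_n.+1} | coflow N f)
      \prod_e sign_weight (if s e then coflow_sign (f e) else omap negb (coflow_sign (f e))).
Proof.
move=> odd_n; rewrite -orient_coflow_sum //.
have [|P PE] := weighted_coflow_sum regN
    (wt := fun e o => sign_weight (if s e then o else omap negb o)).
  by move=> k e o; apply: sign_weight_comp.
apply: A_polynomialP odd_n; exists P => k odd_k.
by rewrite PE // orient_coflow_sum.
Qed.

(** After exchanging sums, the sum over [s] factors over the elements: [y + z] where [f e] is
    nonzero, and [1 + 1] where it is zero. *)
Lemma sum_A_polynomial_orient :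
  \sum_s A_polynomial (orient N s) = potts_mpoly (underlying N) half_yz *+ (2 ^ #|E|).
Proof.
apply: eq_mpoly_odd => n odd_n.
rewrite raddf_sum raddfMn /= -(coflow_support_sum regN); last first.
  by rewrite /half_yz linearZ /= raddfD /= comp_yz_y comp_yz_z.
under eq_bigr do rewrite A_polynomial_orient //.
rewrite exchange_big -sumrMnl; apply: eq_bigr => f _ /=.
rewrite -(bigA_distr_bigA (fun e b =>
  sign_weight (if b then coflow_sign (f e) else omap negb (coflow_sign (f e))))).
rewrite -mulr_natl natrX -prodr_const -big_split; apply: eq_bigr => e _ /=.
rewrite big_bool /coflow_sign; case: eqP => _ /=; first by rewrite mulr1.
rewrite mulr_natl half_yz2; case: (_ < _)%N => //=; exact: addrC.
Qed.

Lemma A_polynomial_diagonal :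
  A_polynomial N \mPo [tuple vq; vy; vy] = potts_mpoly (underlying N) vy.
Proof.
apply: eq_mpoly_odd => n odd_n; rewrite -(coflow_support_sum regN) ?comp_yz_y //.
have NA : is_A_polynomial N (A_polynomial N).
  have [|P PE] := weighted_coflow_sum regN (wt := fun=> sign_weight).
    by move=> k e o; apply: sign_weight_comp.
  apply: A_polynomialP; exists P => k odd_k; rewrite PE //.
  by apply: eq_bigr => f _; rewrite coflow_weightE.
(* Setting [z] to [y] commutes with specializing [q], so it can be applied to the coflow sum. *)
transitivity ((A_polynomial N \mPo [tuple n.+1%:R; vy; vz]) \mPo [tuple vq; vy; vy]).
  rewrite !comp_mpolyA; congr (_ \mPo _); apply: eq_from_tnth => i.
  rewrite 2!tnth_map; case: i => -[|[|[|//]]] ltn; rewrite [in LHS](tnth_nth 0) [in RHS](tnth_nth 0) /=.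
  - by rewrite comp_yz_q rmorph_nat.
  - by rewrite comp_yz_y comp_mpolyXU.
  - by rewrite comp_yz_y comp_mpolyXU.
rewrite NA // raddf_sum; apply: eq_bigr => f _ /=.
rewrite coflow_weightE // rmorph_prod; apply: eq_bigr => e _ /=.
rewrite /coflow_sign; case: (f e =P 0) => _; first by rewrite /= comp_mpoly1.
by case: (_ < _)%N; rewrite /= comp_mpolyXU.
Qed.

End APolynomials.

Lemma eq_potts (K : fieldType) (E : finType) (M M' : matroid E) (q y : K) :
  circuits M = circuits M' -> potts M q y = potts M' q y.
Proof.
move=> MM'; have rkE S : rk M S = rk M' S by rewrite /rk /independent MM'.
rewrite /potts /tutte rkE; congr (_ * _); apply: eq_bigr => S _.
by rewrite rkE.
Qed.

Lemma divr_natr_mulr (K : fieldType) (k : nat) (x : K) : k%:R != 0 :> K ->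
  k%:R^-1 * (x *+ k) = x.
Proof. by move=> k0; rewrite -[x *+ k]mulr_natl mulKf. Qed.

(* Both sides are elements of the field of fractions of Q[q, y, z]. *)
Theorem theorem4p3 (R : realType) :
  let q : {fraction {mpoly rat[3]}} := tofrac vq in
  let y : {fraction {mpoly rat[3]}} := tofrac vy in
  let z : {fraction {mpoly rat[3]}} := tofrac vz in
  (forall (E : finType) (M : matroid E), regular R M ->
     forall vM : oriented_matroid E, orientation R M vM ->
       tofrac (A_polynomial (opposite_double vM)) = potts M q (y * z)
       /\ (2 ^+ #|E|)^-1 *
            (\sum_(s : {ffun E -> bool}) tofrac (A_polynomial (orient vM s)))
          = potts M q ((y + z) / 2))
  /\ (forall (A : finType) (N : oriented_matroid A), oregular R N ->
       tofrac (A_polynomial N \mPo [tuple vq; vy; vy])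
       = potts (underlying N) q y).
Proof.
move=> q y z.
have nat0 k : (0 < k)%N -> (k%:R : {fraction {mpoly rat[3]}}) != 0.
  move=> k0; rewrite -tofrac1 -tofracMn tofrac_eq0.
  by apply/eqP => /(@mpoly_natr_inj k 0) k0'; rewrite k0' in k0.
split=> [E M _ vM [regM MvM]|A N regN]; last first.
  rewrite (A_polynomial_diagonal regN) /y -potts_mpolyE //.
  - by have [] := @meval_neq vy; rewrite ?mevalXU.
  - by have [] := @meval_neq vy; rewrite ?mevalXU.
(* The Potts polynomial depends only on the circuits, so [M] may be replaced by the underlying
   matroid of [vM]. *)
rewrite -!(eq_potts _ _ MvM); split.
  have [] := @meval_neq (vy * vz); rewrite ?mevalM ?mevalXU ?mulr0 ?mulr1 // => w0 w1.
  by rewrite (A_polynomial_double regM) -potts_mpolyE // tofracM.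
have [] := @meval_neq half_yz; rewrite ?mevalZ ?mevalD ?mevalXU ?addr0 ?mulr0 // => w0 w1.
have -> : (y + z) / 2 = tofrac half_yz.
  by rewrite /y /z -tofracD -half_yz2 tofracMn -[X in X / _]mulr_natr mulfK // nat0.
rewrite -raddf_sum (sum_A_polynomial_orient regM) potts_mpolyE // raddfMn -natrX.
by rewrite divr_natr_mulr // nat0 // expn_gt0.
Qed.
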